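(* Let $\lambda_b>0$, $\alpha>2$, $P>0$, $N>0$, $M\ge1$, $\mu\in[1,2]$ and $\Theta>0$. Let $(X_{11},X_{21})$ have joint density $(2\pi\lambda_b)^2x_{11}x_{21}e^{-\pi\lambda_b x_{21}^2}$ on $0<x_{11}<x_{21}$ (zero otherwise), let $\mathbb{A}_{UE}=\{X_{11}\le M^{\frac{1}{\alpha\mu}}(N/P)^{\frac{2-\mu}{\alpha\mu}}X_{21}^{2/\mu}\}$, and for $x>0$ put $\rho(x)=\max\big(x,\,x^{\mu/2}(P/N)^{\frac{2-\mu}{2\alpha}}(1/M)^{\frac{1}{2\alpha}}\big)$. Consider the following random SINR: $X_{11}$ is distributed according to its conditional law given $\mathbb{A}_{UE}$; given $X_{11}=x_{11}$, $$\mathrm{SINR}=\frac{h_{11}x_{11}^{-\alpha}}{\sum_{i\in\Phi_b'}h_iD_i^{-\alpha}\mathbf{1}(D_i\ge\rho(x_{11}))+\frac{N}{P}},$$ where $h_{11}\sim\mathrm{Exp}(1)$, $\Phi_b'$ is an inhomogeneous Poisson point process on $\mathbb{R}^2$ whose intensity at a point at distance $r$ from the origin is $0$ if $r<\rho(x_{11})$ and $\lambda_b\mathbb{P}[\mathbb{A}_{UE}]$ if $r\ge\rho(x_{11})$, $D_i$ is the distance of the $i$-th point of $\Phi_b'$ from the origin, the $h_i$ are i.i.d. $\mathrm{Exp}(1)$, and $h_{11}$, $(h_i)$, $\Phi_b'$ are mutually independent. Then $\mathcal{C}=\mathbb{P}[\mathrm{SINR}\ge\Theta]$ equals $$\mathcal{C}=\frac{2\pi\lambda_b}{\mathbb{P}[\mathbb{A}_{UE}]}\int_0^\infty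 x_{11}\,e^{-\pi\lambda_b\rho(x_{11})^2}\,e^{-\frac{x_{11}^\alpha\Theta N}{P}}\,\mathcal{L}_I(x_{11}^\alpha\Theta;x_{11})\,\mathrm{d}x_{11},$$ where $$\mathcal{L}_I(s;x_{11})=\exp\!\Big(-\frac{2\pi\lambda_b\mathbb{P}[\mathbb{A}_{UE}]}{\alpha-2}\,s\,\big(\rho(x_{11})^2\big)^{1-\frac{\alpha}{2}}\,{}_2F_1\Big[1,1-\tfrac{2}{\alpha};2-\tfrac{2}{\alpha};-s\big(\rho(x_{11})^2\big)^{-\frac{\alpha}{2}}\Big]\Big),$$ ${}_2F_1$ is the Gauss hypergeometric function, and $\mathbb{P}[\mathbb{A}_{UE}]=\int_0^\infty 2(\pi\lambda_b)^2x_{21}e^{-\pi\lambda_b x_{21}^2}\min^2\big(x_{21},M^{\frac{1}{\alpha\mu}}(N/P)^{\frac{2-\mu}{\alpha\mu}}x_{21}^{2/\mu}\big)\mathrm{d}x_{21}$.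
   Context: This is the paper's (approximate) model of the SINR of the typical active user in a downlink cellular network with base-station density $\lambda_b$, transmit power $P$, noise power $N$, path-loss exponent $\alpha$, Rayleigh fading, and a scheduling rule based on the ''treating interference as noise'' condition with parameters $M,\mu$; $\mathcal{L}_I$ is the Laplace transform of the interference. The conditional density of $X_{11}$ given $\mathbb{A}_{UE}$ is $2\pi\lambda_b x e^{-\pi\lambda_b\rho(x)^2}/\mathbb{P}[\mathbb{A}_{UE}]$. *)

(* Defs.v *)
From HB Require Import structures.
From mathcomp Require Import all_boot all_order all_algebra.
From mathcomp Require Import all_classical all_reals all_analysis.
Set Implicit Arguments. Unset Strict Implicit. Unset Printing Implicit Defensive.
Import Order.TTheory GRing.Theory Num.Theory.
Import numFieldNormedType.Exports.
Local Open Scope classical_set_scope.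
Local Open Scope ring_scope.

Section Defs.
Context {R : realType}.

Definition leb2 := ((@lebesgue_measure R) \x (@lebesgue_measure R))%E.

Definition dist0 (y : R * R) : R := Num.sqrt (y.1 ^+ 2 + y.2 ^+ 2).

Definition bounded_set2 (B : set (R * R)) : Prop :=
  exists r : R, forall y, B y -> dist0 y <= r.

Definition Gamma (s : R) : R :=
  fine (\int[@lebesgue_measure R]_(t in [set t : R | (0 < t)%R]) (powR t (s - 1) * expR (- t))%R%:E)%E.

(** Gauss hypergeometric function 2F1[a, b; c; z] for real c > b > 0 and real
    z < 1, given by Euler's integral representation (which on (-oo,1) is the
    analytic continuation of the hypergeometric series). *)
Definition hyp2F1 (a b c z : R) : R :=
  Gamma c / (Gamma b * Gamma (c - b)) *
  fine (\int[@lebesgue_measure R]_(t in [set t : R | (0 < t < 1)%R])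
          (powR t (b - 1) * powR (1 - t) (c - b - 1) * powR (1 - z * t) (- a))%R%:E)%E.

Context {d : measure_display} {T : measurableType d}.

Definition sigma_gen (G : set (set T)) : set (set T) :=
  smallest (sigma_algebra setT) G.

Definition mutually_indep (P : probability T R) (F : nat -> set (set T)) : Prop :=
  forall (J : seq nat) (A : nat -> set T), uniq J ->
    (forall j, j \in J -> F j (A j)) ->
    fine (P (\big[setI/setT]_(j <- J) A j)) = \prod_(j <- J) fine (P (A j)).

Definition exp1_distributed (P : probability T R) (X : T -> R) : Prop :=
  forall t : R, P [set w | X w <= t] = (if t < 0 then 0 else 1 - expR (- t))%:E.

Definition count_eq (s : nat -> R * R) (B : set (R * R)) (k : nat) : Prop :=
  exists l : seq nat, [/\ uniq l, size l = k & forall i, B (s i) <-> i \in l].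

Definition poisson_pmf (m : R) (k : nat) : R := expR (- m) * m ^+ k / k`!%:R.

Definition is_PPP (P : probability T R) (pts : T -> nat -> R * R)
    (lam : R * R -> R) : Prop :=
  forall (n : nat) (B : nat -> set (R * R)) (k : nat -> nat),
    (forall j, (j < n)%N -> measurable (B j) /\ bounded_set2 (B j)) ->
    (forall i j, (i < n)%N -> (j < n)%N -> i != j -> B i `&` B j = set0) ->
    P (\big[setI/setT]_(j < n) [set w | count_eq (pts w) (B j) (k j)])
    = (\prod_(j < n)
         poisson_pmf (fine (\int[leb2]_(y in B j) (lam y)%:E)%E) (k j))%:E.

(** The model for a fixed serving distance: h11 ~ Exp(1); Phi_b' = pts is a PPP
    with intensity lamb' * 1(|y| >= rho); marks hs i i.i.d. Exp(1); and h11,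
    each hs i, and Phi_b' mutually independent (index 0: h11, index 1: the
    point process, index i+2: hs i). *)
Definition SINR_model (P : probability T R) (h11 : T -> R) (hs : nat -> T -> R)
    (pts : T -> nat -> R * R) (lamb' rho : R) : Prop :=
  [/\ measurable_fun setT h11 /\ (forall i, measurable_fun setT (hs i)),
      (forall i, measurable_fun setT (fun w => pts w i)),
      exp1_distributed P h11 /\ (forall i, exp1_distributed P (hs i)),
      is_PPP P pts (fun y => if rho <= dist0 y then lamb' else 0) &
      mutually_indep P (fun j => match j with
         | 0%N => sigma_gen [set h11 @^-1` C | C in measurable]
         | 1%N => sigma_gen [set (fun w => pts w i) @^-1` C
                              | C in [set C' : set (R * R) | measurable C'] & i in setT]
         | i.+2 => sigma_gen [set hs i @^-1` C | C in measurable]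
         end)].

Definition interference (hs : nat -> T -> R) (pts : T -> nat -> R * R)
    (alpha rho : R) (w : T) : \bar R :=
  (\esum_(i in [set: nat])
     (hs i w * powR (dist0 (pts w i)) (- alpha) *
        (if rho <= dist0 (pts w i) then 1 else 0))%R%:E)%E.

(** The event {SINR >= Theta}, with SINR = h11 x^-a / (I + N/P). *)
Definition coverage_event (h11 : T -> R) (hs : nat -> T -> R)
    (pts : T -> nat -> R * R) (alpha Pw Nw Theta x11 rho : R) : set T :=
  [set w | (Theta%:E * (interference hs pts alpha rho w + (Nw / Pw)%:E)
             <= (h11 w * powR x11 (- alpha))%R%:E)%E].

End Defs.

Section Model.
Context {R : realType}.
Variables (lamb alpha Pw Nw M mu : R).

Definition gUE (x21 : R) : R :=
  M `^ (1 / (alpha * mu)) * (Nw / Pw) `^ ((2 - mu) / (alpha * mu)) * x21 `^ (2 / mu).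

Definition rhoUE (x : R) : R :=
  Num.max x (x `^ (mu / 2) * (Pw / Nw) `^ ((2 - mu) / (2 * alpha))
             * (1 / M) `^ (1 / (2 * alpha))).

Definition joint_density (q : R * R) : R :=
  if (0 < q.1) && (q.1 < q.2) then
    (2 * pi * lamb) ^+ 2 * q.1 * q.2 * expR (- (pi * lamb * q.2 ^+ 2))
  else 0.

Definition A_UE : set (R * R) := [set q | q.1 <= gUE q.2].

Definition PA_UE : \bar R := (\int[leb2]_(q in A_UE) (joint_density q)%:E)%E.

(** Laplace transform of the interference, L_I(s; x11) *)
Definition LI (s x11 : R) : R :=
  let r2 := rhoUE x11 ^+ 2 in
  expR (- (2 * pi * lamb * fine PA_UE / (alpha - 2) * s * r2 `^ (1 - alpha / 2)
           * hyp2F1 1 (1 - 2 / alpha) (2 - 2 / alpha) (- s * r2 `^ (- (alpha / 2))))).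

End Model.

(* Main.v *)
Require Import Defs.
From HB Require Import structures.
From mathcomp Require Import all_boot all_order all_algebra.
From mathcomp Require Import all_classical all_reals all_analysis.
From mathcomp Require Import measurable_realfun ring lra.
Set Implicit Arguments. Unset Strict Implicit. Unset Printing Implicit Defensive.
Import Order.TTheory GRing.Theory Num.Theory.
Import numFieldNormedType.Exports.
Local Open Scope classical_set_scope.
Local Open Scope ring_scope.

(** Given [X11 = x], the fading [h11] is exponential, so the coverage probability is
    [exp (- s N / P)] times the Laplace transform at [s = x^alpha Theta] of the
    interference. The path loss is approximated from below by functions that are
    constant on finitely many bounded annuli. For such a function the conditional
    probability given the numbers of points in the annuli is a product over the points,
    by independence of the marks, and averaging over the Poisson counts gives
    [exp (- sum_j Lambda_j (1 - 1 / (1 + s a_j)))]. The annuli are the preimages of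
    dyadic intervals under [t = (|y| / rho)^(-alpha)], which maps the region
    [rho <= |y|] onto (0, 1]; in this variable the sum is a Riemann-type sum that
    increases to Euler's integral for 2F1, so neither polar coordinates nor a change
    of variables is needed. The remaining integrals over [(X11, X21)] are computed by
    Tonelli, using that [x <= g y] and [rho x <= y] agree when [x < y], up to the
    endpoint. *)

(** The point process is known only through its counts on bounded disjoint sets, and its points come
    numbered in an arbitrary way. The marks are multiplied by coefficients that depend on the
    points, so independence can be used only once these coefficients are frozen: a path loss with
    finitely many values is constant on each event that says in which annulus each of the first m
    points lies, and finitely many such events split the probability. The result on each of them
    depends on the counts alone, so the numbering drops out. In the variable t the point at infinity
    is t = 0. The dyadic cell touching 0 would be an unbounded region, so it gets the value 0; all
    other cells are bounded annuli. The region where the variable lies in ]t, 1] has area pi rho^2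
    (t^(-q) - 1) with q = 2 / alpha, so area becomes pi rho^2 times the weight q t^(-q - 1). With z
    = s rho^(-alpha), this weight times 1 - 1 / (1 + z t) is q z times Euler's integrand t^(-q) / (1
    + z t), whose parameter b is 1 - q. *)

Section measurable_sets.
Context {R : realType} {d : measure_display} {T : measurableType d}.
Implicit Types f g : T -> R.

Lemma measurable_set_le f g : measurable_fun setT f -> measurable_fun setT g ->
  measurable [set w | f w <= g w].
Proof.
by move=> mf mg; rewrite -[X in measurable X]setTI; exact: measurable_fun_le.
Qed.

Lemma measurable_set_lt f g : measurable_fun setT f -> measurable_fun setT g ->
  measurable [set w | f w < g w].
Proof.
move=> mf mg.
have -> : [set w | f w < g w] = ~` [set w | g w <= f w].
  by apply/seteqP; split => w /=; rewrite ltNge => /negP.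
by apply: measurableC; exact: measurable_set_le.
Qed.

End measurable_sets.

(** * Product laws, and the tail and Laplace transform of Exp(1) *)

Section independence.
Context {R : realType} {d : measure_display} {T : measurableType d}.
Variable P : probability T R.

Lemma prob_fin_num (A : set T) : measurable A -> P A \is a fin_num.
Proof. by move=> mA; exact: fin_num_measure. Qed.

(** Once the law of [X] is scaled by [P A], the law of [(X, Y)] restricted to [A] agrees with a
    product measure on rectangles, and uniqueness of product measures extends this to every [S].
    Carrying [A] along lets events about other variables pass through the induction on the number of
    marks. *)
Lemma joint_law_indep (X Y : {mfun T >-> R}) (A : set T) : measurable A ->
  (forall C D, measurable C -> measurable D ->
     P (X @^-1` C `&` (Y @^-1` D `&` A)) =
     (P (X @^-1` C) * (P (Y @^-1` D) * P A))%E) ->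
  forall S : set (R * R), measurable S ->
    P ([set w | S (X w, Y w)] `&` A) =
    (P A * (distribution P X \x distribution P Y) S)%E.
Proof.
move=> mA XYA S mS.
have PA0 : 0 <= fine (P A) by exact: fine_ge0.
pose r := NngNum PA0.
have mXY : measurable_fun setT (fun w => (X w, Y w)).
  by apply: measurable_fun_pair; exact: measurable_funP.
pose mu1 := mscale r (distribution P X).
pose mu2 := distribution P Y.
pose HM := isMeasurableFun.Build _ _ _ _ _ mXY.
pose XY : {mfun T >-> (R * R)%type} := HB.pack (fun w => (X w, Y w)) HM.
have := @product_measure_unique _ _ _ _ R mu1 mu2 (pushforward (mrestr P mA) XY).
move=> /(_ mXY _ S mS) pmu.
rewrite -[LHS]/(pushforward (mrestr P mA) XY S) -pmu.
  rewrite /mu1 /product_measure1.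
  rewrite [LHS](@ge0_integral_mscale _ _ R (distribution P X) setT measurableT r
    (fun x => (mu2 \o xsection S) x))//.
    by rewrite /= fineK// prob_fin_num.
  exact: measurable_fun_xsection.
move=> C D mC mD.
rewrite -[LHS]/(P ((X @^-1` C `&` Y @^-1` D) `&` A)).
rewrite -[RHS]/((r%:num%:E * P (X @^-1` C)) * P (Y @^-1` D))%E /=.
rewrite fineK ?prob_fin_num//.
by rewrite -setIA XYA// [(P A * _)%E]muleC -muleA [(P A * _)%E]muleC.
Qed.

(** The distribution function is continuous at [t], so there is no atom and strict and weak
    inequalities have the same probability. *)
Lemma exp1_tail (X : T -> R) t : measurable_fun setT X ->
  exp1_distributed P X -> 0 <= t -> P [set w | t <= X w] = (expR (- t))%:E.
Proof.
move=> mX eX t0.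
have mlt u : measurable [set w | X w < u].
  exact: measurable_set_lt.
have mle u : measurable [set w | X w <= u].
  exact: measurable_set_le.
have -> : [set w | t <= X w] = ~` [set w | X w < t].
  by apply/seteqP; split => w /=; rewrite leNgt => /negP.
rewrite probability_setC//.
have [p Pp] : exists p, P [set w | X w < t] = p%:E.
  by exists (fine (P [set w | X w < t])); rewrite fineK// prob_fin_num.
rewrite Pp -EFinB; congr EFin; apply/eqP; rewrite eq_le; apply/andP; split.
  rewrite leNgt; apply/negP => lt.
  have p1 : 0 < 1 - p by apply: lt_trans lt; exact: expR_gt0.
  have [u pu] := expR_total p1.
  rewrite -pu ltr_expR in lt.
  (* Since [- t < u], half the gap gives [expR (- (t - e)) < expR u = 1 - p]. This contradicts
     [P[X <= t - e] <= p]. *)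
  pose e := (u + t) / 2.
  have e0 : 0 < e by rewrite /e; lra.
  suff : expR u <= expR (- (t - e)) by rewrite ler_expR /e; lra.
  have : (P [set w | (X w <= t - e)%R] <= P [set w | (X w < t)%R])%E.
    apply: le_measure; rewrite ?inE// => w /=; lra.
  rewrite eX Pp lee_fin pu; case: ifPn => [te|_]; last by lra.
  move=> p0; have : 1 <= expR (- (t - e)).
    by rewrite -expR0 ler_expR; lra.
  lra.
have : (P [set w | (X w < t)%R] <= P [set w | (X w <= t)%R])%E.
  by apply: le_measure; rewrite ?inE// => w /=; lra.
by rewrite eX Pp ltNge t0/= lee_fin; lra.
Qed.

(** Only the tail of [X] enters: [1 - expR (- (b * g))] is the integral of the Exp(b) density over
    [[0, g]], and Tonelli turns its mean into the integral of that density against the tail. The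
    maximum with 0 takes care of negative values of [X], which have probability 0 but may occur. *)
Lemma exp1_laplace (X : T -> R) b : measurable_fun setT X ->
  exp1_distributed P X -> 0 <= b ->
  (\int[P]_w (expR (- (b * Num.max (X w) 0)))%:E = ((1 + b)^-1)%:E)%E.
Proof.
move=> mX eX; rewrite le_eqVlt => /predU1P[<-|b0].
  under eq_integral do rewrite mul0r oppr0 expR0.
  by rewrite integral_cst//= probability_setT mule1 addr0 invr1.
pose g w := Num.max (X w) 0.
have g0 w : 0 <= g w by rewrite le_max lexx orbT.
have mg : measurable_fun setT g by exact: measurable_maxr.
have mE : measurable_fun setT (fun w => expR (- (b * g w))).
  apply: measurableT_comp => //; apply: measurableT_comp => //.
  exact: measurable_funM.
have E1 w : expR (- (b * g w)) <= 1.
  by rewrite expR_le1 oppr_le0 mulr_ge0// ltW.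
have bint : (\int[P]_w (1 - expR (- (b * g w)))%:E = (b / (1 + b))%:E)%E.
  pose f (z : T * R) := (exponential_pdf b z.2 *
    \1_[set z : T * R | z.2 <= g z.1] z)%:E.
  have mS : measurable [set z : T * R | z.2 <= g z.1].
    by apply: measurable_set_le => //; exact: measurableT_comp.
  have mf : measurable_fun setT f.
    apply/measurable_EFinP; apply: measurable_funM.
      by apply: measurableT_comp => //; exact: measurable_exponential_pdf.
    exact: measurable_indic.
  have f0 z : (0 <= f z)%E.
    by rewrite lee_fin mulr_ge0// exponential_pdf_ge0// ltW.
  transitivity (\int[P]_w \int[lebesgue_measure]_x f (w, x))%E.
    apply: eq_integral => w _.
    have -> : (fun x => f (w, x)) =
        (fun x => ((EFin \o exponential_pdf b) \_ `]-oo, g w]) x).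
      apply/funext => x; rewrite /f patchE indicE.
      have [xg|xg] := leP x (g w).
        by rewrite !mem_set ?mulr1//= in_itv.
      rewrite !memNset ?mulr0//= ?in_itv/=; apply/negP; by rewrite -ltNge.
    rewrite -integral_mkcond.
    have -> : `]-oo, g w]%classic = `]-oo, 0[%classic `|` `[0, g w]%classic.
      apply/seteqP; split => x /=; rewrite !in_itv/=.
        by case: (ltP x 0) => ? ->; [left|right].
      by move=> [x0|/andP[_ ->]//]; exact: le_trans (ltW x0) (g0 w).
    rewrite ge0_integral_setU//=; last 3 first.
    - apply/measurable_EFinP; apply: measurable_funTS.
      exact: measurable_exponential_pdf.
    - by move=> x _; rewrite lee_fin exponential_pdf_ge0// ltW.
    - apply/disj_setPS => x /=; rewrite !in_itv/= => -[x0 /andP[]].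
      by rewrite leNgt x0.
    rewrite [X in (X + _)%E]integral0_eq ?add0e; last first.
      by move=> x /=; rewrite in_itv/= => x0; rewrite lt0_exponential_pdf.
    move: (g0 w); rewrite le_eqVlt => /predU1P[<-|gw0].
      by rewrite set_itv1 integral_set1 mulr0 oppr0 expR0 subrr.
    rewrite -[RHS]/(exponential_prob b `[0, g w]) exponential_prob_itv0c//.
    by rewrite mulNr EFinB.
  rewrite [LHS](@fubini_tonelli _ _ _ _ R P lebesgue_measure f mf f0).
  (* The Exp(b) density times [expR (- x)] is [b / (1 + b)] times the Exp(1 + b) density, which has
     mass 1. *)
  transitivity (\int[lebesgue_measure]_x
      ((b / (1 + b))%:E * (exponential_pdf (1 + b) x)%:E))%E.
    apply: eq_integral => x _; rewrite /f/=.
    have [x0|x0] := ltP x 0.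
      rewrite !lt0_exponential_pdf// mule0.
      by apply: integral0_eq => w _; rewrite mul0r.
    under eq_integral do rewrite EFinM.
    rewrite ge0_integralZl//; last 2 first.
    - apply/measurable_EFinP.
      exact: (measurable_fun_pair1 x (measurable_indic mS)).
    - by rewrite lee_fin exponential_pdf_ge0// ltW.
    have -> : (fun w => (\1_[set z : T * R | z.2 <= g z.1] (w, x))%:E) =
              (fun w => (\1_[set w : T | x <= g w] w)%:E :> \bar R).
      apply/funext => w; rewrite !indicE; have [xg|xg] := leP x (g w).
        by rewrite !mem_set.
      by rewrite !memNset//=; apply/negP; rewrite -ltNge.
    (* At [x = 0] the event is the whole space, which may be larger than [[0 <= X]]. *)
    have -> : [set w | x <= g w] = if x == 0 then setT else [set w | x <= X w].
      case: eqVneq x0 => [->|xN0] x0; apply/seteqP; split => w //= .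
        by rewrite /g le_max; case/orP => // x1; exfalso; move: xN0; rewrite eq_le x0 x1.
      by rewrite /g le_max => ->.
    rewrite integral_indic//; last first.
      case: ifP => // _.
      exact: measurable_set_le.
    rewrite setIT !exponential_pdfE//=.
    have -> : P (if x == 0 then setT else [set w | x <= X w]) = (expR (- x))%:E.
      case: eqVneq x0 => [->|_] x0; last by rewrite exp1_tail.
      by rewrite probability_setT oppr0 expR0.
    rewrite -!EFinM; congr EFin.
    rewrite -mulrA -expRD mulrA divfK; last by lra.
    by congr (_ * expR _); ring.
  rewrite ge0_integralZl//; last 3 first.
  - by apply/measurable_EFinP; exact: measurable_exponential_pdf.
  - by move=> x _; rewrite lee_fin exponential_pdf_ge0//; lra.
  - by rewrite lee_fin divr_ge0//; lra.
  by rewrite integral_exponential_pdf ?mule1//; lra.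
have : (\int[P]_w ((1 - expR (- (b * g w)))%:E + (expR (- (b * g w)))%:E) = 1)%E.
  under eq_integral do rewrite -EFinD subrK.
  by rewrite integral_cst//= probability_setT mule1.
rewrite ge0_integralD//; last 3 first.
- by move=> w _; rewrite lee_fin subr_ge0.
- by apply/measurable_EFinP; exact: measurable_funB.
- exact/measurable_EFinP.
rewrite bint -/g => h.
have /eqP : (\int[P]_w (expR (- (b * g w)))%:E = 1 - (b / (1 + b))%:E)%E.
  by rewrite -h addeAC subee// add0e.
move=> /eqP ->; rewrite -EFinB; congr EFin.
by field; lra.
Qed.

End independence.

(** * An exponential signal against a weighted sum of independent marks *)

Section exponential_race.
Context {R : realType} {d : measure_display} {T : measurableType d}.
Variables (P : probability T R) (F : nat -> set (set T)).
Hypothesis FP : mutually_indep P F.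
Hypothesis mF : forall j A, F j A -> measurable A.

Lemma mutually_indep_cons (i : nat) (A : set T) (J : seq nat) (B : nat -> set T) :
  uniq (i :: J) -> F i A -> (forall j, j \in J -> F j (B j)) ->
  P (A `&` \big[setI/setT]_(j <- J) B j) =
  (P A * P (\big[setI/setT]_(j <- J) B j))%E.
Proof.
move=> uiJ FA FB.
have mB : measurable (\big[setI/setT]_(j <- J) B j).
  rewrite big_seq; apply: bigsetI_measurable => j jJ.
  by apply: mF; exact: FB.
have mA := mF FA.
have /andP[iJ uJ] := uiJ.
pose B' j := if j == i then A else B j.
have eB' : \big[setI/setT]_(j <- J) B' j = \big[setI/setT]_(j <- J) B j.
  apply: eq_big_seq => j jJ; rewrite /B'; case: eqP => // ji.
  by rewrite -ji jJ in iJ.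
have B'i : B' i = A by rewrite /B' eqxx.
have := FP uiJ (A := B'); rewrite !big_cons eB' B'i.
have -> : \prod_(j <- J) fine (P (B' j)) = \prod_(j <- J) fine (P (B j)).
  apply: eq_big_seq => j jJ; rewrite /B'; case: eqP => // ji.
  by rewrite -ji jJ in iJ.
rewrite -(FP uJ)// => PAB.
rewrite -[LHS]fineK; last by apply: prob_fin_num; exact: measurableI.
rewrite PAB.
  by rewrite EFinM !fineK// prob_fin_num.
move=> j; rewrite inE => /predU1P[->|jJ]; first by rewrite B'i.
by rewrite /B'; case: eqP => [->|_]//; exact: FB.
Qed.

Variables (h : T -> R) (g : nat -> T -> R) (b : nat -> R).
Hypothesis mh : measurable_fun setT h.
Hypothesis mg : forall i, measurable_fun setT (g i).
Hypothesis Fh : forall C, measurable C -> F 0%N (h @^-1` C).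
Hypothesis Fg : forall i C, measurable C -> F i.+2 (g i @^-1` C).

Definition surplus m w := h w - \sum_(i < m) b i * g i w.

Lemma surplusS m w : surplus m.+1 w = surplus m w - b m * g m w.
Proof. by rewrite /surplus big_ord_recr/= opprD addrA. Qed.

Lemma measurable_surplus m : measurable_fun setT (surplus m).
Proof.
elim: m => [|m ih].
  by rewrite (_ : surplus 0 = h)//; apply/funext => w; rewrite /surplus big_ord0 subr0.
rewrite (_ : surplus m.+1 = fun w => surplus m w - b m * g m w).
  by apply: measurable_funB => //; exact: measurable_funM.
by apply/funext => w; rewrite surplusS.
Qed.

HB.instance Definition _ m :=
  isMeasurableFun.Build _ _ _ _ (surplus m) (measurable_surplus m).

(** [surplus m] is built from the indices 0 and 2, ..., m + 1, which leaves index 1 (the points) and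
    the indices from [m.+2] on. In the induction step the hypothesis for the list with [m.+2] added
    separates [surplus m] from [g m], so the pair has a product law on the events considered. *)
Lemma surplus_indep m (J : seq nat) (A : nat -> set T) C : uniq J ->
  (forall j, j \in J -> (j == 1%N) || (m.+2 <= j)%N) ->
  (forall j, j \in J -> F j (A j)) -> measurable C ->
  P (surplus m @^-1` C `&` \big[setI/setT]_(j <- J) A j) =
  (P (surplus m @^-1` C) * P (\big[setI/setT]_(j <- J) A j))%E.
Proof.
elim: m J A C => [|m ih] J A C uJ JP FA mC.
  have -> : surplus 0 = h.
    by apply/funext => w; rewrite /surplus big_ord0 subr0.
  apply: mutually_indep_cons => //; last exact: Fh.
  by rewrite /= uJ andbT; apply/negP => /JP.
pose S := [set z : R * R | C (z.2 - b m * z.1)].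
have mS : measurable S.
  rewrite -[S]setTI -[X in measurable X]/(setT `&` (fun z : R * R => z.2 - b m * z.1) @^-1` C).
  have mm : measurable_fun setT (fun z : R * R => z.2 - b m * z.1).
    by apply: measurable_funB => //; exact: measurable_funM.
  exact: mm.
pose HM := isMeasurableFun.Build _ _ _ _ (g m) (mg m).
pose G : {mfun T >-> R} := HB.pack (g m) HM.
have mJ (K : seq nat) : (forall j, j \in K -> F j (A j)) ->
    measurable (\big[setI/setT]_(j <- K) A j).
  move=> FK; rewrite big_seq; apply: bigsetI_measurable => j jJ.
  by apply: mF; exact: FK.
have mJ2 : m.+2 \notin J.
  by apply/negP => /JP; rewrite /= ltnn.
have jl (K : seq nat) : uniq K -> m.+2 \notin K ->
    (forall j, j \in K -> (j == 1%N) || (m.+3 <= j)%N) ->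
    (forall j, j \in K -> F j (A j)) ->
    P ([set w | S (G w, surplus m w)] `&` \big[setI/setT]_(j <- K) A j) =
    (P (\big[setI/setT]_(j <- K) A j) *
      (distribution P G \x distribution P (surplus m)) S)%E.
  move=> uK mK JK FK; apply: joint_law_indep => //; first exact: mJ.
  move=> D E mD mE.
  pose A' j := if j == m.+2 then g m @^-1` D else A j.
  have eA' : \big[setI/setT]_(j <- K) A' j = \big[setI/setT]_(j <- K) A j.
    apply: eq_big_seq => j jK; rewrite /A'; case: eqP => // ji.
    by rewrite -ji jK in mK.
  have uK' : uniq (m.+2 :: K) by rewrite /= mK.
  have FgD := Fg m mD.
  have A'm : A' m.+2 = g m @^-1` D by rewrite /A' eqxx.
  have := ih (m.+2 :: K) A' E uK'; rewrite !big_cons eA' A'm.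
  rewrite setICA => ->//; last 2 first.
  - move=> j; rewrite inE => /predU1P[->|/JK /orP[->//|]]; first by rewrite leqnn orbT.
    by move=> /ltnW ->; rewrite orbT.
  - move=> j; rewrite inE => /predU1P[->|jK]; first by rewrite A'm.
    by rewrite /A'; case: eqP => [->|_]//; exact: FK.
  rewrite (mutually_indep_cons uK' FgD FK).
  by rewrite muleCA.
have eS : surplus m.+1 @^-1` C = [set w | S (G w, surplus m w)].
  by apply/seteqP; split => w /=; rewrite surplusS.
rewrite eS jl//.
(* The empty list identifies the product-law factor as the probability of the surplus event. *)
have := jl [::]; rewrite !big_nil setIT => -> //.
by rewrite probability_setT mul1e muleC.
Qed.

Hypothesis g0 : forall i w, 0 <= g i w.
Hypothesis b0 : forall i, 0 <= b i.
Hypothesis htail : forall t, 0 <= t -> P [set w | t <= h w] = (expR (- t))%:E.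
Hypothesis glaplace : forall i,
  (\int[P]_w (expR (- (b i * g i w)))%:E = ((1 + b i)^-1)%:E)%E.

(** Memorylessness with a random threshold: given [g m], the threshold for [surplus m] is
    [t + b m * g m], still nonnegative, and the extra factor has mean [(1 + b m)^-1]. Hence the
    induction over all [t >= 0] at once. *)
Lemma surplus_tail m t : 0 <= t -> P [set w | t <= surplus m w] =
  (expR (- t) * \prod_(i < m) (1 + b i)^-1)%:E.
Proof.
elim: m t => [|m ih] t t0.
  rewrite big_ord0 mulr1 -htail//; congr (P _); apply/seteqP.
  by split => w /=; rewrite /surplus big_ord0 subr0.
pose HM := isMeasurableFun.Build _ _ _ _ (g m) (mg m).
pose G : {mfun T >-> R} := HB.pack (g m) HM.
pose S := [set z : R * R | t + b m * z.1 <= z.2].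
have mS : measurable S.
  apply: measurable_set_le => //; apply: measurable_funD => //.
  exact: measurable_funM.
have -> : [set w | t <= surplus m.+1 w] = [set w | S (G w, surplus m w)] `&` setT.
  by apply/seteqP; split => w; rewrite ?setIT /S/= surplusS; lra.
rewrite joint_law_indep//; last first.
  move=> C D mC mD; rewrite setIT probability_setT mule1.
  have := @surplus_indep m [:: m.+2] (fun=> g m @^-1` C) D.
  rewrite !big_cons !big_nil !setIT setIC => ->//; first by rewrite muleC.
  - by move=> j; rewrite inE => /eqP ->; rewrite leqnn orbT.
  - by move=> j; rewrite inE => /eqP ->; exact: Fg.
rewrite probability_setT mul1e.
rewrite -[LHS]/(\int[distribution P G]_x ((distribution P (surplus m)) \o xsection S) x)%E.
rewrite [LHS]ge0_integral_distribution//; last exact: measurable_fun_xsection.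
transitivity (\int[P]_w ((expR (- t) * \prod_(i < m) (1 + b i)^-1)%:E *
   (expR (- (b m * g m w)))%:E))%E.
  apply: eq_integral => w _ /=.
  rewrite -[LHS]/(P (surplus m @^-1` (xsection S (g m w)))).
  have -> : surplus m @^-1` xsection S (g m w) =
      [set w' | t + b m * g m w <= surplus m w'].
    by apply/seteqP; split => w'; rewrite /xsection/= inE.
  rewrite ih; last by rewrite addr_ge0// mulr_ge0.
  by rewrite opprD expRD -EFinM mulrAC.
rewrite ge0_integralZl//; last 2 first.
- apply/measurable_EFinP; apply: measurableT_comp => //.
  by apply: measurableT_comp => //; exact: measurable_funM.
- by rewrite lee_fin mulr_ge0 ?expR_ge0// prodr_ge0// => i _; rewrite invr_ge0 addr_ge0.
by rewrite glaplace -EFinM -mulrA big_ord_recr.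
Qed.

Lemma race_prob m c E : 0 <= c -> F 1%N E ->
  P ([set w | c + \sum_(i < m) b i * g i w <= h w] `&` E) =
  (P E * (expR (- c) * \prod_(i < m) (1 + b i)^-1)%:E)%E.
Proof.
move=> c0 FE.
have -> : [set w | c + \sum_(i < m) b i * g i w <= h w] =
    surplus m @^-1` `[c, +oo[.
  by apply/seteqP; split => w; rewrite /= in_itv/= andbT /surplus; lra.
have := @surplus_indep m [:: 1%N] (fun=> E) `[c, +oo[.
rewrite !big_cons !big_nil !setIT => ->//.
- rewrite muleC -surplus_tail//; congr (_ * P _)%E.
  by apply/seteqP; split => w; rewrite /= in_itv/= andbT.
- by move=> j; rewrite inE => ->.
- by move=> j; rewrite inE => /eqP ->.
Qed.

End exponential_race.

(** * Finite partitions and counts of points *)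

Section partition_count.
Context {R : realType}.

Lemma measure_partition {d : measure_display} {T : measurableType d}
    (P : {measure set T -> \bar R}) (I : finType) (E : I -> set T) (X : set T) :
  measurable X -> (forall i, measurable (E i)) -> trivIset setT E ->
  X `<=` \bigcup_i E i -> P X = (\sum_i P (X `&` E i))%E.
Proof.
move=> mX mE tE XE.
have {1}-> : X = \bigcup_(i in [set` enum I]) (X `&` E i).
  rewrite -setI_bigcupr; apply/esym/setIidPl.
  by apply: subset_trans XE _ => w [i _ Eiw]; exists i => //=; rewrite mem_enum.
rewrite measure_fin_bigcup//.
- by rewrite -fsbig_seq ?enum_uniq// big_enum.
- by apply: (sub_trivIset (@subsetT _ _)); exact: trivIset_setIl.
- by move=> i _; exact: measurableI.
Qed.

(** A count is witnessed by the exact list of indices falling in [B], and there are countably many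
    lists. The measurable structure is left general so that the lemma also applies to the smaller
    sigma-algebra [F1]. *)
Lemma measurable_count_eq {d : measure_display} {T : measurableType d}
    (s : T -> nat -> R * R) (B : set (R * R)) (k : nat) :
  (forall i, measurable [set w | B (s w i)]) ->
  measurable [set w | count_eq (s w) B k].
Proof.
move=> mB.
have -> : [set w | count_eq (s w) B k] = \bigcup_(l : seq nat)
    (if uniq l && (size l == k) then
       \bigcap_(i : nat) (if i \in l then [set w | B (s w i)] else ~` [set w | B (s w i)])
     else set0).
  apply/seteqP; split => w /=.
    move=> [l [ul sl Bl]]; exists l => //; rewrite ul sl eqxx/= => i _.
    by case: ifPn => il /=; rewrite Bl//; exact/negP.
  move=> [l _]; case: ifP => // /andP[ul /eqP sl] Bl; exists l; split => // i.
  have := Bl i I; case: ifPn => il /=; split => //.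
apply: countable_bigcupT_measurable => [|l]; first exact: countableP.
case: ifP => // _; apply: bigcapT_measurable => i.
by case: ifP => _; [exact: mB|apply: measurableC; exact: mB].
Qed.

Lemma count_eq_inj (s : nat -> R * R) B k k' :
  count_eq s B k -> count_eq s B k' -> k = k'.
Proof.
move=> [l [ul <- Bl]] [l' [ul' <- Bl']]; apply: perm_size.
by apply: uniq_perm => // i; apply/idP/idP => [/(Bl i) /(Bl' i)|/(Bl' i) /(Bl i)].
Qed.

Lemma prod_count (s : nat -> R * R) B k m (q : R) : count_eq s B k ->
  (forall i, (m <= i)%N -> ~ B (s i)) ->
  \prod_(i < m) (if `[< B (s i) >] then q else 1) = q ^+ k.
Proof.
move=> [l [ul <- Bl]] Bm.
rewrite (eq_bigr (fun i : 'I_m => if (i : nat) \in l then q else 1)); last first.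
  by move=> i _; congr (if _ then _ else _); apply/asboolP/idP => /Bl.
rewrite -(big_mkord xpredT (fun i => if i \in l then q else 1)) -big_mkcond/=.
rewrite -big_filter (perm_big l)/=; last first.
  apply: uniq_perm => //; first by rewrite filter_uniq// iota_uniq.
  move=> i; rewrite mem_filter mem_index_iota/=; apply: andb_idr => il.
  by rewrite ltnNge; apply/negP => /Bm; apply; exact/Bl.
by rewrite big_const_seq count_predT iter_mulr_1.
Qed.

End partition_count.

(** * Coverage probability for a path loss with finitely many values *)

Section shot_noise_step.
Context {R : realType} {d : measure_display} {T : measurableType d}.
Variables (P : probability T R) (F1 : set (set T)).
Variables (h : T -> R) (g : nat -> T -> R) (pts : T -> nat -> R * R) (c : R).
Hypothesis sF1 : sigma_algebra setT F1.
Hypothesis mF1 : F1 `<=` measurable.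
Hypothesis Fpts : forall i C, measurable C -> F1 ((fun w => pts w i) @^-1` C).
Hypothesis mh : measurable_fun setT h.
Hypothesis mg : forall i, measurable_fun setT (g i).
Hypothesis mpts : forall i, measurable_fun setT (fun w => pts w i).
Hypothesis g0 : forall i w, 0 <= g i w.
Hypothesis race : forall m (b : nat -> R) E, (forall i, 0 <= b i) -> F1 E ->
  P ([set w | c + \sum_(i < m) b i * g i w <= h w] `&` E) =
  (P E * (expR (- c) * \prod_(i < m) (1 + b i)^-1)%:E)%E.

Variables (K : nat) (B : nat -> set (R * R)) (a : nat -> R).
Hypothesis mB : forall j, measurable (B j).
Hypothesis dB : forall i j, (i < K)%N -> (j < K)%N -> i != j -> B i `&` B j = set0.
Hypothesis a0 : forall j, 0 <= a j.

Definition step_fun (y : R * R) : R := \sum_(j < K) a j * \1_(B j) y.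

Lemma step_funE j y : (j < K)%N -> B j y -> step_fun y = a j.
Proof.
move=> jK Bjy; rewrite /step_fun (bigD1 (Ordinal jK))//= big1 ?addr0.
  by rewrite indicE mem_set// mulr1.
move=> i ij; rewrite indicE memNset ?mulr0// => Biy.
have : (B i `&` B j) y by [].
by rewrite dB.
Qed.

Lemma step_fun0 y : (forall j, (j < K)%N -> ~ B j y) -> step_fun y = 0.
Proof.
move=> NB; rewrite /step_fun big1// => i _.
by rewrite indicE memNset ?mulr0//; exact: NB.
Qed.

Lemma step_fun_ge0 y : 0 <= step_fun y.
Proof. by rewrite sumr_ge0// => i _; rewrite mulr_ge0// indicE. Qed.

Lemma measurable_step_fun : measurable_fun setT step_fun.
Proof.
by apply: measurable_sum => i; exact: measurable_funM.
Qed.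

(** [None] is the region outside all [B j], so that the cells partition the plane and a finite
    function records where the first points fall. *)
Definition cell (j : option 'I_K) : set (R * R) :=
  if j is Some j then B j else ~` \big[setU/set0]_(j < K) B j.
Definition cell_val (j : option 'I_K) : R := if j is Some j then a j else 0.

Lemma measurable_cell j : measurable (cell j).
Proof.
by case: j => [j|]/=; [exact: mB|apply: measurableC; exact: bigsetU_measurable].
Qed.

Lemma cellN y : cell None y <-> forall j, (j < K)%N -> ~ B j y.
Proof.
rewrite /cell -bigcup_mkord; split => [NB j jK Bj|NB [j/= jK Bj]].
  by apply: NB; exists j.
exact: NB Bj.
Qed.

Lemma step_fun_cell j y : cell j y -> step_fun y = cell_val j.
Proof. by case: j => [j|]; [exact: step_funE|move/cellN; exact: step_fun0]. Qed.

Lemma cell_inj i j y : cell i y -> cell j y -> i = j.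
Proof.
case: i j => [i|] [j|]//.
- move=> /= Bi Bj; congr Some; apply/val_inj/eqP; apply/negPn/negP => ij.
  by have : (B i `&` B j) y by []; rewrite dB.
- by move=> Bi /cellN /(_ i (ltn_ord i)).
- by move=> /cellN /(_ j (ltn_ord j)).
Qed.

Lemma cell_ex y : exists j, cell j y.
Proof.
have [NB|] := pselect (forall j, (j < K)%N -> ~ B j y).
  by exists None; exact/cellN.
move=> /existsNP[j /not_implyP[jK /contrapT Bj]].
by exists (Some (Ordinal jK)).
Qed.

Definition cells m (k : {ffun 'I_m -> option 'I_K}) : set T :=
  \bigcap_(i in [set: 'I_m]) ((fun w => pts w i) @^-1` cell (k i)).

Definition covered m : set T :=
  [set w | c + \sum_(i < m) step_fun (pts w i) * g i w <= h w].

Definition counts (k : 'I_K -> nat) : set T :=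
  \bigcap_(j in [set: 'I_K]) [set w | count_eq (pts w) (B j) (k j)].

(** On this event the step function vanishes at every later point, so the infinitely many
    constraints of [covered_lim] reduce to [covered m]. *)
Definition quiet_after m : set T :=
  \bigcap_(i in [set i | (m <= i)%N]) ((fun w => pts w i) @^-1` cell None).

(* Events of F1, seen as measurable sets of a second measurable structure. *)
Let TF1 := g_sigma_algebraType F1.

Let F1E : (measurable : set (set TF1)) = F1.
Proof. exact: measurable_g_measurableTypeE. Qed.

Lemma F1_cells m k : F1 (@cells m k).
Proof.
rewrite -F1E; apply: fin_bigcap_measurable => // i _.
by rewrite F1E; apply: Fpts; exact: measurable_cell.
Qed.

Lemma F1_counts k : F1 (counts k).
Proof.
rewrite -F1E; apply: fin_bigcap_measurable => // j _.
by apply: measurable_count_eq => i; rewrite F1E; exact: Fpts.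
Qed.

Lemma F1_quiet_after m : F1 (quiet_after m).
Proof.
rewrite -F1E; apply: bigcap_measurableType => i _.
by rewrite F1E; apply: Fpts; exact: measurable_cell.
Qed.

Lemma F1I A C : F1 A -> F1 C -> F1 (A `&` C).
Proof. by rewrite -F1E; exact: measurableI. Qed.

Lemma measurable_covered m : measurable (covered m).
Proof.
apply: measurable_set_le => //; apply: measurable_funD => //.
apply: measurable_sum => i; apply: measurable_funM => //.
by apply: measurableT_comp => //; exact: measurable_step_fun.
Qed.

(** All points inside some [B j] have index below [m] here, so the product over indices regroups by
    cell and sees only the counts. *)
Lemma prod_step (k : 'I_K -> nat) m w : counts k w -> quiet_after m w ->
  \prod_(i < m) (1 + step_fun (pts w i))^-1 = \prod_(j < K) (1 + a j)^-1 ^+ k j.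
Proof.
move=> kw qw.
rewrite (eq_bigr (fun i : 'I_m => \prod_(j < K)
    (if `[< B j (pts w i) >] then (1 + a j)^-1 else 1))); last first.
  move=> i _; have [[j|] cj] := cell_ex (pts w i).
    rewrite (step_fun_cell cj) (bigD1 j)//= big1 ?mulr1; first by rewrite asboolT.
    move=> j' j'j; rewrite asboolF// => Bj'.
    by have := @cell_inj (Some j) (Some j') _ cj Bj' => -[] /esym /eqP; apply/negP.
  rewrite (step_fun_cell cj) addr0 invr1 big1// => j _.
  by rewrite asboolF//; apply: (cellN _).1.
rewrite exchange_big/=; apply: eq_bigr => j _.
rewrite (@prod_count _ (pts w) (B j) (k j) m)//; first exact: kw.
by move=> i mi; apply: (cellN _).1 => //; exact: qw.
Qed.

(** Splitting by [cells] freezes the random coefficients, so [race] applies to each part; by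
    [prod_step] all nonempty parts give the same factor, which comes out of the sum. *)
Lemma covered_quiet (k : 'I_K -> nat) m :
  P (covered m `&` (counts k `&` quiet_after m)) =
  (P (counts k `&` quiet_after m) *
    (expR (- c) * \prod_(j < K) (1 + a j)^-1 ^+ k j)%:E)%E.
Proof.
set E := counts k `&` quiet_after m.
have FE : F1 E by apply: F1I; [exact: F1_counts|exact: F1_quiet_after].
have mE := mF1 FE.
have mC := measurable_covered m.
have mcells (k' : {ffun 'I_m -> option 'I_K}) : measurable (cells k').
  by apply: mF1; exact: F1_cells.
have tcells : trivIset setT (@cells m).
  apply/trivIsetP => k1 k2 _ _ /eqP k12; rewrite -subset0 => w [w1 w2].
  apply: k12.
  by apply/ffunP => i; apply: cell_inj; [exact: w1|exact: w2].
have ucells (X : set T) : X `<=` \bigcup_k @cells m k.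
  move=> w _; have [f fP] := choice (fun i : 'I_m => cell_ex (pts w i)).
  by exists (finfun f) => // i _ /=; rewrite ffunE.
rewrite (measure_partition P (measurableI _ _ mC mE) mcells tcells)//.
rewrite (measure_partition P mE mcells tcells)//.
rewrite ge0_sume_distrl; last by [].
apply: eq_bigr => k' _.
(* A nonempty part contains some [w], whose coefficients serve as the constants [b] on the whole
   part. *)
have [E0|] := eqVneq (E `&` cells k') set0.
  by rewrite -setIA E0 setI0 !measure0 mul0e.
move=> /set0P[w [[cw qw] cellw]].
rewrite -(prod_step cw qw).
rewrite -(@race m (fun i => step_fun (pts w i)))//; last 2 first.
- by move=> i; exact: step_fun_ge0.
- by apply: F1I => //; exact: F1_cells.
have ecell w' : cells k' w' -> \sum_(i < m) step_fun (pts w' i) * g i w' =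
    \sum_(i < m) step_fun (pts w i) * g i w'.
  move=> cellw'; apply: eq_bigr => i _.
  by rewrite (step_fun_cell (cellw' i I)) (step_fun_cell (cellw i I)).
congr (P _); rewrite -setIA; apply/seteqP.
by split=> w' [cw' [Ew' cellw']]; split => //; move: cw';
  rewrite /covered/= (ecell _ cellw').
Qed.

Definition covered_lim : set T := \bigcap_(m : nat) covered m.

Lemma measurable_covered_lim : measurable covered_lim.
Proof. by apply: bigcapT_measurable => m; exact: measurable_covered. Qed.

Lemma covered_lim_quiet m :
  covered_lim `&` quiet_after m = covered m `&` quiet_after m.
Proof.
apply/seteqP; split => w [cw qw]; split => //; first exact: cw.
move=> n _; apply: le_trans cw; rewrite lerD2l.
rewrite -!(big_mkord xpredT (fun i => step_fun (pts w i) * g i w)).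
have t0 i : 0 <= step_fun (pts w i) * g i w by rewrite mulr_ge0// step_fun_ge0.
(* Terms are nonnegative and vanish from index [m] on, so enlarging the range to [maxn n m] bounds
   the partial sum up to [n] by the one up to [m]. *)
apply: (@le_trans _ _ (\sum_(0 <= i < maxn n m) step_fun (pts w i) * g i w)).
  by rewrite [leRHS](big_cat_nat (leq0n n) (leq_maxl _ _))//= lerDl sumr_ge0.
rewrite (big_cat_nat (leq0n m) (leq_maxr _ _))//=.
rewrite [X in _ + X]big_nat_cond [X in _ + X]big1 ?addr0// => i /andP[/andP[mi _] _].
by rewrite (step_fun_cell (qw i mi)) mul0r.
Qed.

Lemma quiet_after_nd : nondecreasing_seq quiet_after.
Proof.
move=> m n mn; apply/subsetPset => w qw i ni.
by apply: qw; exact: leq_trans ni.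
Qed.

(** Finite counts bound the indices of the points lying in the finitely many [B j]. *)
Lemma counts_quiet k : counts k `<=` \bigcup_m quiet_after m.
Proof.
move=> w kw.
have : forall j : 'I_K, exists m, forall i, (m <= i)%N -> ~ B j (pts w i).
  move=> j; have [l [_ _ Bl]] := kw j I.
  exists (\max_(i <- l) i.+1)%N => i; rewrite leqNgt => /negP li /Bl il; apply: li.
  exact: (@leq_bigmax_seq _ l xpredT (fun i => i.+1) i il isT).
move=> /choice[f fP]; exists (\max_(j < K) f j)%N => // i /= mi.
apply/cellN => j jK; apply: (fP (Ordinal jK)).
by apply: leq_trans mi; exact: leq_bigmax.
Qed.

(** Continuity from below along [quiet_after] removes the truncation from [covered_quiet]. *)
Lemma covered_lim_counts (k : 'I_K -> nat) :
  P (covered_lim `&` counts k) = (P (counts k) *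
    (expR (- c) * \prod_(j < K) (1 + a j)^-1 ^+ k j)%:E)%E.
Proof.
set C := (_ * \prod_(_ < _) _).
have mq m : measurable (quiet_after m) by apply: mF1; exact: F1_quiet_after.
have mk : measurable (counts k) by apply: mF1; exact: F1_counts.
have mc := measurable_covered_lim.
have cvg_quiet X : measurable X -> X `<=` counts k ->
    P (X `&` quiet_after m) @[m --> \oo] --> P X.
  move=> mX Xk.
  have {2}-> : X = \bigcup_m (X `&` quiet_after m).
    rewrite -setI_bigcupr; apply/esym/setIidPl.
    by apply: subset_trans Xk _; exact: counts_quiet.
  apply: nondecreasing_cvg_mu.
  - by move=> m; exact: measurableI.
  - by apply: bigcupT_measurable => m; exact: measurableI.
  - move=> m n mn; apply/subsetPset; apply: setIS.
    by apply/subsetPset; exact: quiet_after_nd.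
apply: (@cvg_unique _ _ (P ((covered_lim `&` counts k) `&` quiet_after m) @[m --> \oo])).
- exact: ereal_hausdorff.
- by apply: cvg_quiet; [exact: measurableI|exact: subIsetr].
have -> : (fun m => P (covered_lim `&` counts k `&` quiet_after m)) =
    (fun m => P (counts k `&` quiet_after m) * C%:E)%E.
  apply/funext => m; rewrite -covered_quiet.
  by rewrite -setIA setICA covered_lim_quiet setICA.
by apply: cvgeZr => //; exact: cvg_quiet.
Qed.

Lemma trivIset_counts L : trivIset setT
  (fun k : {ffun 'I_K -> 'I_L} => counts (fun j => k j)).
Proof.
apply/trivIsetP => k1 k2 _ _ /eqP k12; rewrite -subset0 => w [w1 w2].
apply: k12; apply/ffunP => j; apply: val_inj => /=.
exact: count_eq_inj (w1 j I) (w2 j I).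
Qed.

Lemma cvg_prod_ord n (u : 'I_n -> nat -> R) (l : 'I_n -> R) :
  (forall j, u j L @[L --> \oo] --> l j) ->
  \prod_(j < n) u j L @[L --> \oo] --> \prod_(j < n) l j.
Proof.
elim: n u l => [|n ih] u l ul.
  by rewrite big_ord0; under eq_fun do rewrite big_ord0; exact: cvg_cst.
rewrite big_ord_recr/=; under eq_fun do rewrite big_ord_recr/=.
by apply: cvgM => //; apply: ih.
Qed.

(** The Poisson generating function. It is used at [q = (1 + a j)^-1] for the answer and at [q = 1]
    for the total mass. *)
Lemma cvg_poisson_gen (m q : R) :
  \sum_(l < L) Defs.poisson_pmf m l * q ^+ l @[L --> \oo] --> expR (- (m * (1 - q))).
Proof.
have -> : (fun L : nat => \sum_(l < L) Defs.poisson_pmf m l * q ^+ l) =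
    (fun L => expR (- m) * series (exp_coeff (m * q)) L).
  apply/funext => L; rewrite /series/= big_mkord mulr_sumr; apply: eq_bigr => l _.
  by rewrite /Defs.poisson_pmf /exp_coeff/= exprMn; ring.
have -> : expR (- (m * (1 - q))) = expR (- m) * expR (m * q).
  by rewrite -expRD; congr expR; ring.
apply: cvgM; first exact: cvg_cst.
exact: is_cvg_series_exp_coeff.
Qed.

(** The events [counts k] need not cover the sample space, since a count may be infinite. Their
    Poisson weights have total mass 1, so what [H L] leaves out has probability [1 - p1 L], which
    tends to 0 and closes the squeeze. *)
Lemma covered_lim_prob (mm : 'I_K -> R) :
  (forall k, P (counts k) = (\prod_(j < K) Defs.poisson_pmf (mm j) (k j))%:E) ->
  P covered_lim =
  (expR (- c) * \prod_(j < K) expR (- (mm j * (1 - (1 + a j)^-1))))%:E.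
Proof.
move=> Pk.
have mk k : measurable (counts k) by apply: mF1; exact: F1_counts.
have mc := measurable_covered_lim.
(* Bounding every count by [L] leaves finitely many count vectors, over which a product of truncated
   sums expands. *)
pose H L := \bigcup_(k : {ffun 'I_K -> 'I_L}) counts (fun j => k j).
have mH L : measurable (H L).
  by apply: fin_bigcup_measurable => //; exact: finite_finset.
have PH L X : measurable X -> P (X `&` H L) =
    (\sum_(k : {ffun 'I_K -> 'I_L}) P (X `&` counts (fun j => k j)))%E.
  move=> mX; rewrite (measure_partition P (measurableI _ _ mX (mH L))
    (fun k : {ffun 'I_K -> 'I_L} => mk (fun j => k j)) (@trivIset_counts L)); last exact: subIsetr.
  apply: eq_bigr => k _; rewrite -setIA [H L `&` _]setIidr//.
  by move=> w kw; exists k.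
have PHT L : P (H L) = (\prod_(j < K) \sum_(l < L) Defs.poisson_pmf (mm j) l * 1 ^+ l)%:E.
  rewrite -[H L]setTI PH// bigA_distr_bigA/= -sumEFin; apply: eq_bigr => k _.
  rewrite setTI Pk; congr EFin; apply: eq_bigr => j _.
  by rewrite expr1n mulr1.
have PHC L : P (covered_lim `&` H L) = (expR (- c) *
    \prod_(j < K) \sum_(l < L) Defs.poisson_pmf (mm j) l * (1 + a j)^-1 ^+ l)%:E.
  rewrite PH// bigA_distr_bigA/= mulr_sumr -sumEFin; apply: eq_bigr => k _.
  rewrite covered_lim_counts Pk -EFinM; congr EFin.
  by rewrite mulrCA -big_split.
have cvg1 : \prod_(j < K) \sum_(l < L) Defs.poisson_pmf (mm j) l * 1 ^+ l @[L --> \oo] --> (1 : R).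
  have := @cvg_prod_ord K _ _ (fun j => @cvg_poisson_gen (mm j) 1).
  by rewrite [X in _ --> X -> _]big1// => j _; rewrite subrr mulr0 oppr0 expR0.
have cvgC := @cvg_prod_ord K _ _ (fun j => @cvg_poisson_gen (mm j) (1 + a j)^-1).
set S := \prod_(j < K) _ in cvgC *.
have Pcf : P covered_lim \is a fin_num by exact: prob_fin_num.
rewrite -(fineK Pcf); congr EFin.
set p1 := (fun L : nat => _) in cvg1.
set p2 := (fun L : nat => _) in cvgC.
have bnd L : expR (- c) * p2 L <= fine (P covered_lim) <= expR (- c) * p2 L + (1 - p1 L).
  rewrite -!lee_fin fineK// -PHC measureIl//= EFinD EFinB -PHC -PHT.
  rewrite -probability_setC//.
  have -> : P covered_lim = P ((covered_lim `&` H L) `|` (covered_lim `\` H L)).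
    by rewrite setUIDK.
  apply: le_trans (measureU2 _ _ _) _ => //.
  - exact: measurableI.
  - exact: measurableD.
  rewrite leeD2l//; apply: le_measure; rewrite ?inE//.
  exact: measurableD.
  exact: measurableC.
apply: (@cvg_unique R _ (fine (P covered_lim) @[L --> \oo])).
- exact: Rhausdorff.
- exact: cvg_cst.
apply: (@squeeze_cvgr _ _ _ _ (fun L => expR (- c) * p2 L)
   (fun L => expR (- c) * p2 L + (1 - p1 L))).
- by near=> L; exact: bnd.
- by apply: cvgM => //; exact: cvg_cst.
- rewrite -[X in _ --> X]addr0; apply: cvgD.
    by apply: cvgM => //; exact: cvg_cst.
  by rewrite -(subrr 1); apply: cvgB => //; exact: cvg_cst.
Unshelve. all: by end_near. Qed.

End shot_noise_step.

(** * Areas of disks and annuli *)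

Section disk_area.
Context {R : realType}.
Notation mu := (@lebesgue_measure R).

Lemma is_derive_derive1 (F : R -> R) (t v : R) :
  is_derive t 1 F v -> derivable F t 1 /\ derive1 F t = v.
Proof. by move=> [dF Fv]; rewrite derive1E. Qed.

(** The substitution [x = r cos t] on [[0, pi]] gives [2 r^2 sin^2 t], with primitive
    [r^2 (t - sin t cos t)]. *)
Lemma integral_half_disk (r : R) : 0 < r ->
  (\int[mu]_(x in `[(- r)%R, r]) (2 * Num.sqrt (r ^+ 2 - x ^+ 2))%:E = (pi * r ^+ 2)%:E)%E.
Proof.
move=> r0.
pose F (t : R) := r * cos t.
have dF t : derivable F t 1 /\ derive1 F t = - (r * sin t).
  apply: is_derive_derive1; apply: is_derive_eq.
  by rewrite scalerN.
have F'E : derive1 F = fun t => - (r * sin t) by apply/funext => t; have [] := dF t.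
have cF' : continuous (fun t : R => - (r * sin t)).
  move=> t; apply: cvgN; apply: cvgM; first exact: cvg_cst.
  exact: continuous_sin.
have cF : continuous F.
  move=> t; apply: cvgM; first exact: cvg_cst.
  exact: continuous_cos.
pose G x := 2 * Num.sqrt (r ^+ 2 - x ^+ 2).
have cG : continuous G.
  move=> x; apply: cvgM; first exact: cvg_cst.
  apply: continuous_comp; last exact: sqrt_continuous.
  by apply: cvgB; [exact: cvg_cst|exact: exprn_continuous].
have := @integration_by_substitution_decreasing R F G 0 pi (pi_ge0 R).
rewrite /F cos0 cospi mulr1 mulrN1 -/F => ->; last 6 first.
- move=> s t s0 t0; rewrite /F ltr_pM2l// => st.
  by rewrite ltr_cos.
- by move=> t _; rewrite F'E; exact: cF'.
- by rewrite F'E; apply/cvg_ex; eexists; apply: cvg_at_right_filter; exact: cF'.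
- by rewrite F'E; apply/cvg_ex; eexists; apply: cvg_at_left_filter; exact: cF'.
- split.
  + by move=> t _; have [] := dF t.
  + by apply: cvg_at_right_filter; exact: cF.
  + by apply: cvg_at_left_filter; exact: cF.
- exact: continuous_subspaceT.
pose A (t : R) := r ^+ 2 * (t - sin t * cos t).
have dA t : derivable A t 1 /\ derive1 A t = 2 * r ^+ 2 * sin t ^+ 2.
  apply: is_derive_derive1; apply: is_derive_eq.
  rewrite -[LHS]/(r ^+ 2 * (1 - (sin t * - sin t + cos t * cos t))).
  by rewrite -(expr2 (cos t)) cos2sin2; ring.
have cA : continuous A.
  move=> t; have [dAt _] := dA t.
  exact/differentiable_continuous/derivable1_diffP.
transitivity (\int[mu]_(x in `[0%R, pi]) (2 * r ^+ 2 * sin x ^+ 2)%:E)%E.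
  apply: eq_integral => t; rewrite inE/= in_itv/= => /andP[t0 tpi].
  congr EFin.
  rewrite -[LHS]/(2 * Num.sqrt (r ^+ 2 - (r * cos t) ^+ 2) * - derive1 F t).
  rewrite F'E opprK.
  have -> : r ^+ 2 - (r * cos t) ^+ 2 = (r * sin t) ^+ 2.
    by rewrite !exprMn sin2cos2; ring.
  rewrite sqrtr_sqr ger0_norm; last by rewrite mulr_ge0 ?(ltW r0)// sin_ge0_pi// t0.
  by ring.
rewrite (@continuous_FTC2 _ _ A)//.
- by rewrite -EFinB /A sinpi sin0 !mul0r !subr0 mulr0 subr0 mulrC.
- exact: pi_gt0.
- apply: continuous_subspaceT => t; apply: cvgM; first exact: cvg_cst.
  exact: (cvg_comp _ _ (@continuous_sin R t) (@exprn_continuous R 2 (sin t))).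
- split.
  + by move=> t _; have [] := dA t.
  + by apply: cvg_at_right_filter; exact: cA.
  + by apply: cvg_at_left_filter; exact: cA.
- by move=> t _; have [] := dA t.
Qed.

Lemma measurable_dist0 : measurable_fun setT (@dist0 R).
Proof.
apply: measurableT_comp.
  by apply: continuous_measurable_fun; exact: sqrt_continuous.
by apply: measurable_funD; apply: measurable_funX.
Qed.

(** The section at [x] is an open interval of half-length [Num.sqrt (r ^+ 2 - x ^+ 2)]. The root of
    a negative number is 0, so the formula also gives the empty sections beyond the disk. *)
Lemma disk_area (r : R) : 0 < r ->
  leb2 [set y : R * R | dist0 y < r] = (pi * r ^+ 2)%:E.
Proof.
move=> r0.
have E x : mu (xsection [set y : R * R | dist0 y < r] x) =
    (2 * Num.sqrt (r ^+ 2 - x ^+ 2))%:E.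
  set s := Num.sqrt _.
  have s0 : 0 <= s by exact: sqrtr_ge0.
  have -> : xsection [set y : R * R | dist0 y < r] x = `]- s, s[%classic.
    apply/seteqP; split => y; rewrite /xsection/= inE/= in_itv/= -ltr_norml /dist0/=.
      rewrite -[X in _ < X -> _](ger0_norm (ltW r0)) -(sqrtr_sqr r).
      rewrite ltr_sqrt ?exprn_gt0// => yr.
      by rewrite -(sqrtr_sqr y) ltr_sqrt; nra.
    move=> ys; rewrite -[ltRHS](ger0_norm (ltW r0)) -(sqrtr_sqr r).
    have : 0 < s by apply: le_lt_trans ys.
    rewrite sqrtr_gt0 => rx.
    by move: ys; rewrite /s -(sqrtr_sqr y) !ltr_sqrt ?exprn_gt0//; nra.
  rewrite lebesgue_measure_itv/= lte_fin; case: ifPn => [_|].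
    by rewrite -EFinB; congr EFin; ring.
  by rewrite -leNgt => ss; congr EFin; lra.
rewrite -integral_half_disk//.
transitivity (\int[mu]_x (2 * Num.sqrt (r ^+ 2 - x ^+ 2))%:E)%E.
  by apply: eq_integral => x _; rewrite -E.
rewrite [RHS]integral_mkcond; apply: eq_integral => x _.
rewrite patchE; case: ifPn => //; rewrite notin_setE/= in_itv/= => xr.
rewrite ler0_sqrtr ?mulr0// subr_le0.
have : r <= `|x| by rewrite leNgt; apply/negP => /ltW; rewrite ler_norml.
by move=> rx; rewrite -(real_normK (num_real x)) ler_sqr ?nnegrE// ltW.
Qed.

Lemma annulus_area (r1 r2 : R) : 0 < r1 -> r1 <= r2 ->
  leb2 [set y : R * R | r1 <= dist0 y < r2] = (pi * (r2 ^+ 2 - r1 ^+ 2))%:E.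
Proof.
move=> r10 r12.
have m r : measurable [set y : R * R | dist0 y < r].
  by apply: measurable_set_lt => //; exact: measurable_dist0.
have -> : [set y : R * R | r1 <= dist0 y < r2] =
    [set y | dist0 y < r2] `\` [set y | dist0 y < r1].
  apply/seteqP; split => y /=; rewrite leNgt.
    by move=> /andP[/negP ? ?].
  by move=> [-> /negP ->].
rewrite /leb2 measureD//=.
  rewrite setIidr; last by move=> y /= yr; exact: lt_le_trans r12.
  rewrite -[X in (X - _)%E]/(leb2 _) -[X in (_ - X)%E]/(leb2 _).
  by rewrite !disk_area// ?(lt_le_trans r10)// -EFinB mulrBr.
- exact: m.
- exact: m.
- have : (leb2 [set y : R * R | (dist0 y < r2)%R] < +oo)%E.
    by rewrite disk_area ?(lt_le_trans r10)// ltry.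
  exact.
Qed.

End disk_area.

(** * Integrals of powers and of the exponential *)

Section power_integrals.
Context {R : realType}.
Notation mu := (@lebesgue_measure R).

Lemma continuous_powR (p t : R) : 0 < t -> {for t, continuous (fun u : R => u `^ p)}.
Proof.
move=> t0; apply/differentiable_continuous/derivable1_diffP.
by have [] := is_derive1_powR p t0.
Qed.

Lemma within_continuous_powR (q p a b : R) : 0 < a ->
  {within `[a, b], continuous (fun t : R => q * t `^ p)}.
Proof.
move=> a0; apply: continuous_in_subspaceT => t; rewrite inE/= in_itv/= => /andP[at_ _].
apply: cvgM; first exact: cvg_cst.
by apply: continuous_powR; exact: lt_le_trans at_.
Qed.

Lemma integral_powR (c p a b : R) : p != 0 -> 0 < a -> a < b ->
  (\int[mu]_(t in `]a, b]) (c * t `^ (p - 1))%:E = (c / p * (b `^ p - a `^ p))%:E)%E.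
Proof.
move=> p0 a0 ab.
rewrite integral_itv_obnd_cbnd; last first.
  apply/measurable_EFinP; apply: measurable_funM => //.
  by apply: measurable_funTS; exact: measurable_powR.
rewrite mulrBr EFinB.
have cF (t : R) : 0 < t -> {for t, continuous (fun t : R => c / p * t `^ p)}.
  by move=> t0; apply: cvgM; [exact: cvg_cst|exact: continuous_powR].
have dF (t : R) : 0 < t -> is_derive t 1 (fun t : R => c / p * t `^ p) (c * t `^ (p - 1)).
  move=> t0; have := is_derive1_powR p t0 => dt; apply: is_derive_eq.
  by rewrite /GRing.scale/= mulrA divfK.
apply: (@continuous_FTC2 _ _ (fun t => c / p * t `^ p)) => //.
- exact: within_continuous_powR.
- split => [t||].
  + by rewrite in_itv/= => /andP[at_ _]; have [] := dF _ (lt_trans a0 at_).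
  + by apply: cvg_at_right_filter; exact: cF.
  + by apply: cvg_at_left_filter; apply: cF; exact: lt_trans ab.
- move=> t; rewrite in_itv/= => /andP[at_ _].
  by have [dt] := dF _ (lt_trans a0 at_); rewrite derive1E.
Qed.

(** For [p < 1] the integrand is unbounded near 0, so the interval is exhausted by []b / n.+2, b]];
    with [n.+2] the left end is below [b] already for [n = 0]. *)
Lemma integral0_powR (p b : R) : 0 < p -> 0 < b ->
  (\int[mu]_(t in `]0%R, b]) (p * t `^ (p - 1))%:E = (b `^ p)%:E)%E.
Proof.
move=> p0 b0.
pose F (n : nat) := `]b / n.+2%:R, b]%classic.
have bn (n : nat) : b / n.+2%:R < b.
  by rewrite ltr_pdivrMr// ltr_pMr// ltr1n.
have UF : \bigcup_n F n = `]0, b]%classic.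
  apply/seteqP; split => x.
    move=> [n _]; rewrite /F /= !in_itv/= => /andP[bx ->]; rewrite andbT.
    by apply: le_lt_trans bx; rewrite divr_ge0// ltW.
  rewrite /= in_itv/= => /andP[x0 xb].
  exists (Num.bound (b / x)) => //; rewrite /F /= in_itv/= xb andbT.
  rewrite ltr_pdivrMr// mulrC -ltr_pdivrMr//.
  apply: lt_le_trans (archi_boundP _) _; first by rewrite divr_ge0// ltW.
  by rewrite ler_nat -addn2 leq_addr.
have mf D : measurable_fun D (fun t : R => (p * t `^ (p - 1))%:E).
  apply/measurable_EFinP; apply: measurable_funM => //.
  by apply: measurable_funTS; exact: measurable_powR.
have ndF : nondecreasing_seq F.
  move=> m n mn; apply/subsetPset => x; rewrite /F/= !in_itv/= => /andP[bx ->].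
  rewrite andbT; apply: le_lt_trans bx; rewrite ler_pM2l// lef_pV2 ?posrE//.
  by rewrite ler_nat !ltnS.
apply: (@cvg_unique _ _ ((\int[mu]_(x in F n) (p * x `^ (p - 1))%:E)%E @[n --> \oo])).
- exact: ereal_hausdorff.
- rewrite -UF; apply: ge0_nondecreasing_set_cvg_integral => //.
  + by move=> n; exact: measurable_itv.
  + by move=> n; exact: mf.
  + by move=> n x _; rewrite lee_fin mulr_ge0 ?powR_ge0// ltW.
have -> : (fun n => \int[mu]_(x in F n) (p * x `^ (p - 1))%:E)%E =
    (fun n : nat => (b `^ p - (b / n.+2%:R) `^ p)%:E).
  apply/funext => n; rewrite integral_powR ?gt_eqF// ?divr_gt0//.
  by rewrite divff ?gt_eqF// mul1r.
apply: cvg_EFin; first exact: nearW.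
rewrite -[X in _ --> X]subr0; apply: cvgB; first exact: cvg_cst.
have [+ _] := @cvg_at_rightP R (fun t => t `^ p) 0 0; apply; first exact: powR_cvg0.
split => [n|]; first by rewrite divr_gt0.
rewrite -(mulr0 b); apply: cvgM; first exact: cvg_cst.
by have : [sequence (@harmonic R) n.+1]_n @ \oo --> (0 : R);
  first by rewrite cvg_shiftS; exact: cvg_harmonic.
Qed.

Lemma integral_expRN (a : R) :
  (\int[mu]_(t in `[a, +oo[) (expR (- t))%:E = (expR (- a))%:E)%E.
Proof.
have cE : continuous (fun t : R => expR (- t)).
  move=> t; apply: continuous_comp; last exact: continuous_expR.
  exact: cvgN.
rewrite (@ge0_continuous_FTC2y _ (fun t => expR (- t)) (fun t => - expR (- t)) a 0)//.
- by rewrite sub0e EFinN oppeK.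
- exact: continuous_subspaceT.
- by rewrite -oppr0; apply: cvgN; exact: cvgr_expR.
- by apply: cvg_at_right_filter; apply: cvgN; exact: cE.
- move=> t _; rewrite derive1E; apply: derive_val.
  by apply: is_derive_eq; rewrite mulrN1 opprK.
Qed.

End power_integrals.

(** * Gamma factors and Euler's integral *)

Section gamma_euler.
Context {R : realType}.
Notation mu := (@lebesgue_measure R).

Lemma integral_mul_indic (D : set R) (g : R -> R) :
  (\int[mu]_x (g x * \1_D x)%:E = \int[mu]_(x in D) (g x)%:E)%E.
Proof.
rewrite [RHS]integral_mkcond; apply: eq_integral => x _.
rewrite patchE indicE; case: ifPn => _; first by rewrite mulr1.
by rewrite mulr0.
Qed.

Lemma set_gt0_itv : [set t : R | 0 < t] = `]0, +oo[%classic.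
Proof. by apply/seteqP; split => t; rewrite /= in_itv/= andbT. Qed.

Let Gint (s : R) : \bar R :=
  (\int[mu]_(t in [set t : R | (0 < t)%R]) (t `^ (s - 1) * expR (- t))%:E)%E.

Let measurable_Gint_integrand D (s : R) :
  measurable_fun D (fun t : R => (t `^ (s - 1) * expR (- t))%:E).
Proof.
apply/measurable_EFinP; apply: measurable_funTS; apply: measurable_funM.
  exact: measurable_powR.
by apply: measurableT_comp => //; exact: measurable_expR.
Qed.

(** Tonelli for [p x^(p - 1) e^(- y)] on [0 < x <= y]: integrating over [y] first gives [p Gint p],
    over [x] first gives [Gint (p + 1)]. *)
Let Gint_rec (p : R) : 0 < p -> Gint (p + 1) = (p%:E * Gint p)%E.
Proof.
move=> p0.
pose S := [set y : R * R | 0 < y.1] `&` [set y : R * R | y.1 <= y.2].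
pose f (y : R * R) := (p * y.1 `^ (p - 1) * expR (- y.2) * \1_S y)%:E.
have mS : measurable S.
  by apply: measurableI; [apply: measurable_set_lt|apply: measurable_set_le].
have mf : measurable_fun setT f.
  apply/measurable_EFinP; apply: measurable_funM; last exact: measurable_indic.
  apply: measurable_funM.
    apply: measurable_funM => //.
    by apply: (measurableT_comp (measurable_powR _)).
  by apply: measurableT_comp => //; exact: measurableT_comp.
have f0 y : (0 <= f y)%E.
  by rewrite lee_fin !mulr_ge0 ?expR_ge0 ?powR_ge0// ltW.
have := @fubini_tonelli _ _ _ _ R mu mu f mf f0.
have -> : (\int[mu]_x \int[mu]_y f (x, y) = p%:E * Gint p)%E.
  rewrite /Gint -ge0_integralZl//; last 4 first.
  - by rewrite set_gt0_itv; exact: measurable_itv.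
  - exact: measurable_Gint_integrand.
  - by move=> t _; rewrite lee_fin mulr_ge0 ?powR_ge0 ?expR_ge0.
  - by rewrite lee_fin ltW.
  rewrite [RHS]integral_mkcond; apply: eq_integral => x _.
  rewrite patchE; case: ifPn => [|].
    rewrite inE/= => x0.
    transitivity (\int[mu]_y ((p * x `^ (p - 1))%:E * (expR (- y) * \1_`[x, +oo[ y)%:E))%E.
      apply: eq_integral => y _; rewrite /f -EFinM/= -mulrA; congr (_ * (_ * _))%:E.
      rewrite !indicE; have [xy|xy] := leP x y.
        by rewrite !mem_set//= in_itv/= xy.
      rewrite !memNset//= ?in_itv/= ?andbT; first by apply/negP; rewrite -ltNge.
      by move=> [_]; rewrite /= leNgt xy.
    rewrite ge0_integralZl//.
    - by rewrite integral_mul_indic integral_expRN -!EFinM mulrA.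
    - apply/measurable_EFinP; apply: measurable_funM; last exact: measurable_indic.
      exact: measurableT_comp.
    - by rewrite lee_fin mulr_ge0 ?powR_ge0// ltW.
  rewrite notin_setE/= => x0; apply: integral0_eq => y _.
  by rewrite /f indicE memNset ?mulr0// => -[].
move=> ->; rewrite /Gint [LHS]integral_mkcond; apply: eq_integral => t _.
rewrite patchE; case: ifPn => [|].
  rewrite inE/= => t0.
  transitivity (\int[mu]_x ((expR (- t))%:E * (p * x `^ (p - 1) * \1_`]0%R, t] x)%:E))%E.
    rewrite ge0_integralZl//.
    - by rewrite integral_mul_indic integral0_powR// -EFinM addrK mulrC.
    - apply/measurable_EFinP; apply: measurable_funM; last exact: measurable_indic.
      by apply: measurable_funM => //; exact: measurable_powR.
    - by move=> y _; rewrite lee_fin !mulr_ge0 ?powR_ge0// ltW.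
  apply: eq_integral => x _; rewrite /f -EFinM/= mulrA; congr (_ * _)%:E.
    by rewrite mulrC.
  rewrite !indicE; have [/andP[x0 xt]|xt] := boolP ((0 < x) && (x <= t)).
    by rewrite !mem_set//= in_itv/= x0 xt.
  rewrite !memNset//= ?in_itv/=; first by move=> [/= x0 xt']; rewrite x0 xt' in xt.
  exact/negP.
rewrite notin_setE/= => t0; apply/esym; apply: integral0_eq => x _.
rewrite /f indicE memNset ?mulr0// => -[/= x0 xt]; apply: t0.
exact: lt_le_trans xt.
Qed.

Let Gint1 : Gint 1 = 1%E.
Proof.
rewrite /Gint; under eq_integral do rewrite subrr powRr0 mul1r.
rewrite set_gt0_itv integral_itv_obnd_cbnd; first by rewrite integral_expRN oppr0 expR0.
apply/measurable_EFinP; apply: measurable_funTS.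
exact: measurableT_comp.
Qed.

Lemma integral_powR01 (p : R) : 0 < p ->
  (\int[mu]_(t in `]0%R, 1%R]) (t `^ (p - 1))%:E = (p^-1)%:E)%E.
Proof.
move=> p0; have := integral0_powR p0 ltr01; rewrite powR1.
under eq_integral do rewrite EFinM.
rewrite ge0_integralZl//; last 3 first.
- by apply/measurable_EFinP; apply: measurable_funTS; exact: measurable_powR.
- by move=> t _; rewrite lee_fin powR_ge0.
- by rewrite lee_fin ltW.
move=> h; rewrite -[LHS]mul1e -[X in (X * _)%E](_ : (p^-1)%:E * p%:E = 1)%E; last first.
  by rewrite -EFinM mulVf// gt_eqF.
by rewrite -muleA h mule1.
Qed.

(** As [fine] sends [+oo] to 0, positivity says at once that the integral is finite and nonzero,
    which is what cancelling [Gamma p] takes. The upper bound compares with [t^(p - 1)] on []0, 1]]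
    and, because [p <= 1], with [e^(- t)] beyond 1. *)
Let Gint_fin (p : R) : 0 < p <= 1 -> 0 < fine (Gint p).
Proof.
move=> /andP[p0 p1].
have lb : ((expR (- 1) * p^-1)%:E <= Gint p)%E.
  rewrite EFinM -(integral_powR01 p0) -ge0_integralZl//; last 2 first.
  - by apply/measurable_EFinP; apply: measurable_funTS; exact: measurable_powR.
  - by move=> t _; rewrite lee_fin powR_ge0.
  rewrite /Gint set_gt0_itv.
  apply: (@le_trans _ _ (\int[mu]_(t in `]0%R, 1%R]) (t `^ (p - 1) * expR (- t))%:E)%E).
    apply: ge0_le_integral => //.
    - by move=> t _; rewrite mule_ge0// lee_fin ?expR_ge0 ?powR_ge0.
    - apply/measurable_EFinP; apply: measurable_funM => //.
      by apply: measurable_funTS; exact: measurable_powR.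
    - exact: measurable_Gint_integrand.
    - move=> t; rewrite /= in_itv/= => /andP[_ t1].
      by rewrite -EFinM lee_fin mulrC ler_wpM2l ?powR_ge0// ler_expR lerN2.
  apply: ge0_subset_integral => //.
  - exact: measurable_Gint_integrand.
  - by move=> t _; rewrite lee_fin mulr_ge0 ?powR_ge0 ?expR_ge0.
  - by move=> t; rewrite /= !in_itv/= => /andP[->].
have ub : (Gint p <= (p^-1 + 1)%:E)%E.
  rewrite /Gint set_gt0_itv.
  have -> : `]0, +oo[%classic = `]0, 1] `|` `]1%R, +oo[ :> set R.
    apply/seteqP; split => t /=; rewrite !in_itv/= !andbT.
      by move=> t0; have [t1|t1] := leP t 1; [left; rewrite t0|right].
    by move=> [/andP[]//|]; exact: lt_trans.
  rewrite ge0_integral_setU//=; last 3 first.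
  - exact: measurable_Gint_integrand.
  - by move=> t _; rewrite lee_fin mulr_ge0 ?powR_ge0 ?expR_ge0.
  - apply/disj_setPS => t /=; rewrite !in_itv/= andbT => -[/andP[_ t1]].
    by rewrite ltNge t1.
  rewrite EFinD; apply: leeD.
    rewrite -(integral_powR01 p0); apply: ge0_le_integral => //.
    - by move=> t _; rewrite lee_fin mulr_ge0 ?powR_ge0 ?expR_ge0.
    - exact: measurable_Gint_integrand.
    - by apply/measurable_EFinP; apply: measurable_funTS; exact: measurable_powR.
    - move=> t; rewrite /= in_itv/= => /andP[t0 _].
      by rewrite lee_fin ler_piMr ?powR_ge0// expR_le1 oppr_le0 ltW.
  have e1 : (\int[mu]_(t in `]1%R, +oo[) (expR (- t))%:E <= 1)%E.
    rewrite integral_itv_obnd_cbnd; first by rewrite integral_expRN lee_fin expR_le1.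
    by apply/measurable_EFinP; apply: measurable_funTS; exact: measurableT_comp.
  apply: le_trans e1; apply: ge0_le_integral => //.
  - by move=> t _; rewrite lee_fin mulr_ge0 ?powR_ge0 ?expR_ge0.
  - exact: measurable_Gint_integrand.
  - by apply/measurable_EFinP; apply: measurable_funTS; exact: measurableT_comp.
  - move=> t; rewrite /= in_itv/= andbT => t1.
    rewrite lee_fin ler_piMl ?expR_ge0// -[leRHS](powRr0 t).
    by apply: ler_powR; [exact: ltW|rewrite subr_le0].
have fG : Gint p \is a fin_num.
  rewrite ge0_fin_numE; first exact: le_lt_trans ub (ltry _).
  by apply: le_trans lb; rewrite lee_fin mulr_ge0 ?expR_ge0// invr_ge0 ltW.
rewrite -lte_fin fineK//; apply: lt_le_trans lb.
by rewrite lte_fin mulr_gt0 ?expR_gt0 ?invr_gt0.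
Qed.

Lemma measurable_euler_integrand (p z : R) : 0 <= z ->
  measurable_fun (`]0, 1]%classic : set R) (fun t : R => t `^ (p - 1) * (1 + z * t)^-1).
Proof.
move=> z0; apply: measurable_funM.
  by apply: measurable_funTS; exact: measurable_powR.
apply: (@eq_measurable_fun _ _ _ _ _ (fun t : R => (1 + z * t) `^ (-1))).
  move=> t; rewrite inE/= in_itv/= => /andP[t0 _].
  by rewrite powR_inv1// addr_ge0// mulr_ge0// ltW.
apply: measurable_funTS; apply: (measurableT_comp (measurable_powR _)).
by apply: measurable_funD => //; exact: measurable_funM.
Qed.

(** For [c = b + 1] the power of [1 - t] has exponent 0 and the Gamma quotient is [p]. *)
Lemma hyp2F1_euler (p z : R) : 0 < p <= 1 -> 0 <= z -> hyp2F1 1 p (p + 1) (- z) =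
  p * fine (\int[mu]_(t in `]0%R, 1%R]) (t `^ (p - 1) * (1 + z * t)^-1)%:E)%E.
Proof.
move=> p01 z0; have /andP[p0 _] := p01.
have -> : (\int[mu]_(t in `]0%R, 1%R]) (t `^ (p - 1) * (1 + z * t)^-1)%:E =
    \int[mu]_(t in [set t : R | (0 < t < 1)%R]) (t `^ (p - 1) *
       (1 - t) `^ (p + 1 - p - 1) * (1 - - z * t) `^ (- 1))%:E)%E.
  have -> : [set t : R | 0 < t < 1] = `]0, 1[%classic.
    by apply/seteqP; split => t; rewrite /= in_itv.
  rewrite -integral_itv_bndo_bndc; last first.
    apply/measurable_EFinP.
    apply: measurable_funS (measurable_euler_integrand _ z0) => //.
    by move=> t; rewrite /= !in_itv/= => /andP[-> /ltW].
  apply: eq_integral => t; rewrite inE/= in_itv/= => /andP[t0 _].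
  rewrite [p + 1]addrC addrK subrr powRr0 mulr1 mulNr opprK powR_inv1//.
  by rewrite addr_ge0// mulr_ge0// ltW.
rewrite /hyp2F1; congr (_ * _); rewrite /Gamma -!/(Gint _).
have -> : p + 1 - p = 1 by ring.
rewrite Gint1 Gint_rec// mulr1.
have Gp := Gint_fin p01.
have fG : Gint p \is a fin_num.
  by move: Gp; case: (Gint p) => //=; rewrite ltxx.
by rewrite fineM//= mulfK// gt_eqF.
Qed.

Lemma euler_integral_fin (p z : R) : 0 < p -> 0 <= z ->
  (\int[mu]_(t in `]0%R, 1%R]) (t `^ (p - 1) * (1 + z * t)^-1)%:E)%E \is a fin_num.
Proof.
move=> p0 z0.
have i0 t : `]0, 1]%classic t -> 0 <= t `^ (p - 1) * (1 + z * t)^-1.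
  rewrite /= in_itv/= => /andP[t0 _].
  by rewrite mulr_ge0 ?powR_ge0// invr_ge0 addr_ge0// mulr_ge0// ltW.
rewrite ge0_fin_numE; last by apply: integral_ge0 => t /i0; rewrite lee_fin.
apply: (@le_lt_trans _ _ (p^-1)%:E); last exact: ltry.
rewrite -(integral_powR01 p0); apply: ge0_le_integral => //.
- by apply/measurable_EFinP; exact: measurable_euler_integrand.
- by apply/measurable_EFinP; apply: measurable_funTS; exact: measurable_powR.
- move=> t; rewrite /= in_itv/= => /andP[t0 _].
  rewrite lee_fin ler_piMr ?powR_ge0// invf_le1; last first.
    by rewrite ltr_wpDr// mulr_ge0// ltW.
  by rewrite lerDl mulr_ge0// ltW.
Qed.

End gamma_euler.

(** * Dyadic lower sums and their limit *)

Section dyadic_sums.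
Context {R : realType}.
Notation mu := (@lebesgue_measure R).

Definition dyad (n m : nat) : R := m%:R / 2 ^+ n.

Lemma dyad_le n m m' : (dyad n m <= dyad n m') = (m <= m')%N.
Proof. by rewrite /dyad ler_pM2r ?ler_nat// invr_gt0 exprn_gt0. Qed.

Lemma dyad_lt n m m' : (dyad n m < dyad n m') = (m < m')%N.
Proof. by rewrite /dyad ltr_pM2r ?ltr_nat// invr_gt0 exprn_gt0. Qed.

Lemma dyadS n m : dyad n.+1 m.*2 = dyad n m.
Proof.
rewrite /dyad exprS -muln2 natrM invfM mulrA mulfK//; exact/pnatr_eq0.
Qed.

Lemma dyad0 n : dyad n 0 = 0. Proof. by rewrite /dyad mul0r. Qed.

Lemma dyad_exp n : dyad n (2 ^ n) = 1.
Proof. by rewrite /dyad natrX divff// expf_neq0// pnatr_eq0. Qed.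

Lemma dyad_succ n m : dyad n m.+1 = dyad n m + (2 ^+ n)^-1.
Proof. by rewrite /dyad -natr1 mulrDl mul1r. Qed.

Lemma dyad_cell_ex n t : 0 < t <= 1 ->
  exists m, (m < 2 ^ n)%N /\ dyad n m < t <= dyad n m.+1.
Proof.
move=> /andP[t0 t1]; elim: n => [|n [m [mn /andP[mt tm]]]].
  by exists 0%N; rewrite expn0 dyad0 /dyad expr0 divr1 t0 t1.
have [tm'|tm'] := leP t (dyad n.+1 m.*2.+1).
  exists m.*2; rewrite dyadS mt tm'; split=> //.
  by rewrite expnS mul2n ltn_double.
exists m.*2.+1; rewrite tm' -doubleS dyadS tm; split=> //.
by rewrite expnS mul2n ltn_Sdouble.
Qed.

Lemma dyad_cell_uniq n m m' t : dyad n m < t <= dyad n m.+1 ->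
  dyad n m' < t <= dyad n m'.+1 -> m = m'.
Proof.
move=> /andP[mt tm] /andP[mt' tm'].
have := lt_le_trans mt tm'; have := lt_le_trans mt' tm.
by rewrite !dyad_lt !ltnS => ? ?; apply/eqP; rewrite eqn_leq; apply/andP.
Qed.

(** The value at the left end of each dyadic cell of []0, 1]], an approximation from below for
    increasing [psi]. The cell touching 0 is left out: it stands for an unbounded region, and its
    value would be [psi 0 = 0]. *)
Definition dyad_sum (psi : R -> R) n t : R := \sum_(j < (2 ^ n).-1)
  psi (dyad n j.+1) * \1_(`]dyad n j.+1, dyad n j.+2]%classic) t.

Lemma dyad_sumE psi n m t : psi 0 = 0 -> (m < 2 ^ n)%N ->
  dyad n m < t <= dyad n m.+1 -> dyad_sum psi n t = psi (dyad n m).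
Proof.
move=> psi0 mn mt; rewrite /dyad_sum.
have uniq (j : nat) : t \in `]dyad n j.+1, dyad n j.+2] -> j.+1 = m.
  by rewrite in_itv/= => /dyad_cell_uniq; exact.
case: m => [|m] in mn mt uniq *.
  rewrite dyad0 psi0 big1// => j _.
  by rewrite indicE memNset ?mulr0//= => /uniq.
have mn' : (m < (2 ^ n).-1)%N by rewrite -ltnS prednK// expn_gt0.
rewrite (bigD1 (Ordinal mn'))//= big1 ?addr0.
  by rewrite indicE mem_set ?mulr1//= in_itv.
move=> j jm; rewrite indicE memNset ?mulr0//= => /uniq [] jm'.
by move/eqP: jm; apply; exact: val_inj.
Qed.

Lemma dyad_sum0 psi n t : ~ (0 < t <= 1) -> dyad_sum psi n t = 0.
Proof.
move=> t01; rewrite /dyad_sum big1// => j _.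
rewrite indicE memNset ?mulr0//= in_itv/= => /andP[jt tj]; apply: t01.
apply/andP; split; first by apply: le_lt_trans jt; rewrite divr_ge0// exprn_ge0.
apply: le_trans tj _; rewrite -(dyad_exp n) dyad_le.
by have := ltn_ord j; rewrite -ltnS prednK// expn_gt0.
Qed.

(** Refining the cell that contains [t] can only move its left end to the right. *)
Lemma dyad_sum_nd psi n t : psi 0 = 0 -> {in Num.nneg &, {homo psi : x y / x <= y}} ->
  dyad_sum psi n t <= dyad_sum psi n.+1 t.
Proof.
move=> psi0 psind; have [t01|t01] := boolP (0 < t <= 1); last first.
  by rewrite !dyad_sum0//; exact/negP.
have [m [mn mt]] := dyad_cell_ex n t01.
have [m' [mn' mt']] := dyad_cell_ex n.+1 t01.
rewrite (dyad_sumE psi0 mn mt) (dyad_sumE psi0 mn' mt') -(dyadS n m).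
apply: psind; rewrite ?nnegrE; [by rewrite divr_ge0// exprn_ge0..|].
move: mt mt' => /andP[mt _] /andP[_ tm'].
by have := lt_le_trans mt tm'; rewrite -dyadS dyad_lt ltnS dyad_le.
Qed.

Lemma dyad_sum_ge0 psi n t : (forall u, 0 <= u -> 0 <= psi u) -> 0 <= dyad_sum psi n t.
Proof.
move=> psi0; rewrite sumr_ge0// => j _; rewrite mulr_ge0 ?psi0 ?indicE//.
by rewrite divr_ge0// exprn_ge0.
Qed.

Lemma dyad_sum_id n t : 0 < t <= 1 ->
  dyad_sum id n t <= t <= dyad_sum id n t + (2 ^+ n)^-1.
Proof.
move=> t01; have [m [mn /andP[mt tm]]] := dyad_cell_ex n t01.
by rewrite (@dyad_sumE _ _ m)// ?mt// (ltW mt) -dyad_succ tm.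
Qed.

Lemma dyad_sum_comp psi n t : psi 0 = 0 -> 0 < t <= 1 ->
  dyad_sum psi n t = psi (dyad_sum id n t).
Proof.
by move=> psi0 t01; have [m [mn mt]] := dyad_cell_ex n t01; rewrite !(dyad_sumE _ mn mt).
Qed.

Lemma cvg_dyad_sum_id t : 0 < t <= 1 -> dyad_sum id n t @[n --> \oo] --> t.
Proof.
move=> t01.
apply: (@squeeze_cvgr _ _ _ _ (fun n => t - (2^-1) ^+ n) (fun=> t)).
- near=> n; have /andP[le1 le2] := dyad_sum_id n t01.
  by rewrite le1 andbT exprVn lerBlDr.
- rewrite -[X in _ --> X]subr0; apply: cvgB; first exact: cvg_cst.
  by apply: cvg_expr; rewrite ger0_norm; lra.
- exact: cvg_cst.
Unshelve. all: by end_near. Qed.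

(* A Riemann-type sum for the weight q t^(-q-1), whose integral over a cell is
   the difference of the values of t^(-q) at its ends. *)
Lemma cvg_dyadic_riemann (q z : R) : 0 < q < 1 -> 0 <= z ->
  \sum_(j < (2 ^ n).-1) (1 - (1 + z * dyad n j.+1)^-1) *
    (dyad n j.+1 `^ (- q) - dyad n j.+2 `^ (- q)) @[n --> \oo] -->
  q * z * fine (\int[mu]_(t in `]0%R, 1%R]) (t `^ (1 - q - 1) * (1 + z * t)^-1)%:E)%E.
Proof.
move=> /andP[q0 q1] z0.
pose psi u := 1 - (1 + z * u)^-1.
have psi0 : psi 0 = 0 by rewrite /psi mulr0 addr0 invr1 subrr.
have psi_ge0 u : 0 <= u -> 0 <= psi u.
  move=> u0; rewrite subr_ge0 invf_le1; last by rewrite ltr_wpDr// mulr_ge0.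
  by rewrite lerDl mulr_ge0.
have psi_nd : {in Num.nneg &, {homo psi : x y / x <= y}}.
  move=> x y; rewrite !nnegrE => x0 y0 xy; rewrite lerB// lef_pV2 ?posrE.
  - by rewrite lerD2l ler_wpM2l.
  - by rewrite ltr_wpDr// mulr_ge0.
  - by rewrite ltr_wpDr// mulr_ge0.
pose w (t : R) := q * t `^ (- q - 1).
have w0 t : 0 <= w t by rewrite mulr_ge0 ?powR_ge0// ltW.
have mw : measurable_fun setT w.
  by apply: measurable_funM => //; exact: measurable_powR.
pose G n t := (dyad_sum psi n t * w t)%:E.
have intG n : (\int[mu]_t G n t = (\sum_(j < (2 ^ n).-1)
    (1 - (1 + z * dyad n j.+1)^-1) *
    (dyad n j.+1 `^ (- q) - dyad n j.+2 `^ (- q)))%:E)%E.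
  transitivity (\int[mu]_t \sum_(j < (2 ^ n).-1) ((psi (dyad n j.+1))%:E *
      (w t * \1_(`]dyad n j.+1, dyad n j.+2]%classic) t)%:E))%E.
    apply: eq_integral => t _; rewrite /G /dyad_sum mulr_suml -sumEFin.
    by apply: eq_bigr => j _; rewrite -EFinM; congr EFin; ring.
  have mj (j : nat) : measurable_fun setT
      (fun t => (w t * \1_(`]dyad n j.+1, dyad n j.+2]%classic) t)%:E).
    by apply/measurable_EFinP; apply: measurable_funM.
  rewrite ge0_integral_sum//; last 2 first.
  - by move=> j; apply: emeasurable_funM => //; exact: mj.
  - move=> j t _; rewrite mule_ge0// lee_fin.
      by apply: psi_ge0; rewrite divr_ge0// exprn_ge0.
    by rewrite mulr_ge0// indicE.
  rewrite -sumEFin; apply: eq_bigr => j _.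
  rewrite ge0_integralZl//; last 3 first.
  - exact: mj.
  - by move=> t _; rewrite lee_fin mulr_ge0// indicE.
  - by rewrite lee_fin; apply: psi_ge0; rewrite divr_ge0// exprn_ge0.
  rewrite integral_mul_indic integral_powR; last 3 first.
  - by rewrite oppr_eq0 gt_eqF.
  - by rewrite divr_gt0// exprn_gt0.
  - by rewrite dyad_lt.
  rewrite -EFinM; congr EFin; congr (_ * _).
  by rewrite invrN mulrN divff ?gt_eqF// mulN1r opprB.
pose I := (\int[mu]_(t in `]0%R, 1%R]) (t `^ (1 - q - 1) * (1 + z * t)^-1)%:E)%E.
have Ifin : I \is a fin_num by apply: euler_integral_fin => //; rewrite subr_gt0.
(* The left ends of the cells around [t] tend to [t] and [psi] is continuous;
   [psi t = z t / (1 + z t)] then turns [psi t * w t] into Euler's integrand. *)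
have limG t : dyad_sum psi n t * w t @[n --> \oo] -->
    q * z * (t `^ (1 - q - 1) * (1 + z * t)^-1) * \1_(`]0, 1]%classic) t.
  rewrite indicE; have [t01|t01] := boolP (0 < t <= 1); last first.
    rewrite memNset ?mulr0; last by rewrite /= in_itv/=; exact/negP.
    rewrite (_ : (fun n => _) = cst 0); first exact: cvg_cst.
    by apply/funext => k; rewrite dyad_sum0 ?mul0r//; exact/negP.
  rewrite mem_set ?mulr1; last by rewrite /= in_itv.
  have /andP[t0 _] := t01.
  have zt : 0 < 1 + z * t by rewrite ltr_wpDr// mulr_ge0// ltW.
  have -> : q * z * (t `^ (1 - q - 1) * (1 + z * t)^-1) = psi t * w t.
    rewrite /psi /w; have -> : 1 - q - 1 = 1 + (- q - 1) by ring.
    rewrite powRD; last by apply/implyP => _; rewrite gt_eqF.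
    by rewrite powRr1 ?ltW//; field; rewrite gt_eqF.
  apply: cvgM; last exact: cvg_cst.
  rewrite (_ : (fun n => _) = (fun n => psi (dyad_sum id n t))); last first.
    by apply/funext => k /=; rewrite dyad_sum_comp.
  apply: (cvg_comp _ _ (cvg_dyad_sum_id t01)).
  apply: cvgB; first exact: cvg_cst.
  apply: cvgV; first by rewrite gt_eqF.
  apply: cvgD; first exact: cvg_cst.
  by apply: cvgM; [exact: cvg_cst|exact: cvg_id].
have cvgI : (\int[mu]_t G n t)%E @[n --> \oo] -->
    (\int[mu]_t ((q * z * (t `^ (1 - q - 1) * (1 + z * t)^-1)) *
       \1_(`]0%R, 1%R]%classic) t)%:E)%E.
  rewrite (_ : integral _ _ _ = \int[mu]_t limn (G ^~ t))%E; last first.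
    apply: eq_integral => t _; apply/esym/cvg_lim => //.
    by apply/fine_cvgP; split; [exact: nearW|exact: limG].
  apply: cvg_monotone_convergence => //.
  - move=> k; apply/measurable_EFinP; apply: measurable_funM => //.
    by apply: measurable_sum => i; exact: measurable_funM.
  - by move=> k t _; rewrite lee_fin mulr_ge0// dyad_sum_ge0.
  - move=> t _; apply/nondecreasing_seqP => k; rewrite lee_fin ler_wpM2r//.
    exact: dyad_sum_nd.
move: cvgI; rewrite integral_mul_indic.
under eq_integral do rewrite EFinM.
rewrite ge0_integralZl//; last 3 first.
- by apply/measurable_EFinP; exact: measurable_euler_integrand.
- move=> t; rewrite /= in_itv/= => /andP[t0 _].
  by rewrite lee_fin mulr_ge0 ?powR_ge0// invr_ge0 addr_ge0// mulr_ge0// ltW.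
- by rewrite lee_fin mulr_ge0// ltW.
rewrite -[X in _ --> (_ * X)%E](fineK Ifin) -EFinM.
under eq_fun do rewrite intG.
by move=> /fine_cvgP[_].
Qed.

End dyadic_sums.

(** * Annuli as preimages of dyadic cells *)

Section annuli.
Context {R : realType}.
Variables (alpha rho s : R).
Hypothesis alpha_gt2 : 2 < alpha.
Hypothesis rho_gt0 : 0 < rho.
Hypothesis s_ge0 : 0 <= s.

Let alpha_gt0 : 0 < alpha. Proof. exact: lt_trans alpha_gt2. Qed.
Let alpha_neq0 : alpha != 0. Proof. by rewrite gt_eqF. Qed.

(** The inverse of the normalised path loss [tau] as a function of the distance; it decreases in
    [t]. *)
Definition radius (t : R) : R := rho * t `^ (- alpha^-1).

Lemma radius_ge0 t : 0 < t -> 0 < radius t.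
Proof. by move=> t0; rewrite mulr_gt0// powR_gt0. Qed.

Lemma lt_radius d t : 0 < d -> 0 < t -> (d < radius t) = (t < (d / rho) `^ (- alpha)).
Proof.
move=> d0 t0.
have dr : 0 < d / rho by rewrite divr_gt0.
rewrite -(ltr_ln (x := d)) ?posrE ?radius_ge0// -(ltr_ln (x := t)) ?posrE ?powR_gt0//.
rewrite /radius lnM ?posrE ?powR_gt0// !ln_powR ln_div ?posrE//.
rewrite -[RHS](ltr_pM2r (x := alpha^-1)) ?invr_gt0//.
have -> : - alpha * (ln d - ln rho) / alpha = ln rho - ln d by field.
by rewrite mulNr mulrC; apply/idP/idP; lra.
Qed.

Lemma radius_sqr t : 0 < t -> radius t ^+ 2 = rho ^+ 2 * t `^ (- (2 / alpha)).
Proof.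
move=> t0; rewrite /radius exprMn; congr (_ * _).
by rewrite -powR_mulrn ?powR_ge0// -powRrM; congr (_ `^ _); field.
Qed.

Lemma le_radius t : 0 < t <= 1 -> rho <= radius t.
Proof.
move=> /andP[t0 t1]; rewrite ler_peMr ?(ltW rho_gt0)// powRN.
rewrite invf_ge1 ?powR_gt0// -[leRHS](_ : 1 `^ alpha^-1 = 1); last by rewrite powR1.
by apply: ge0_ler_powR => //; rewrite ?nnegrE ?invr_ge0//; exact: ltW.
Qed.

Lemma radius_anti t u : 0 < t -> t <= u -> radius u <= radius t.
Proof.
move=> t0 tu; have u0 := lt_le_trans t0 tu.
rewrite ler_pM2l// !powRN lef_pV2 ?posrE ?powR_gt0//.
by apply: ge0_ler_powR => //; rewrite ?nnegrE ?invr_ge0//; exact: ltW.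
Qed.

(** The indices are crossed because [radius] decreases; the half-open bounds match [tau y] in []dyad
    n j.+1, dyad n j.+2]]. *)
Definition annulus n j : set (R * R) :=
  [set y | radius (dyad n j.+2) <= dist0 y < radius (dyad n j.+1)].

Let dyad_gt0 n m : 0 < dyad n m.+1 :> R.
Proof. by rewrite divr_gt0// exprn_gt0. Qed.

Lemma measurable_annulus n j : measurable (annulus n j).
Proof.
have -> : annulus n j = [set y | radius (dyad n j.+2) <= dist0 y] `&`
    [set y | dist0 y < radius (dyad n j.+1)].
  by apply/seteqP; split => y /= => [/andP[]//|[? ?]]; exact/andP.
have md := @measurable_dist0 R.
by apply: measurableI; [exact: measurable_set_le|exact: measurable_set_lt].
Qed.

Lemma bounded_annulus n j : bounded_set2 (annulus n j).
Proof. by exists (radius (dyad n j.+1)) => y /andP[_ /ltW]. Qed.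

Lemma annulus_disj n i j : i != j -> annulus n i `&` annulus n j = set0.
Proof.
wlog: i j / (i < j)%N => [wl ij|ij _].
  have := ij; rewrite neq_ltn => /orP[] h; first exact: wl.
  by rewrite setIC; apply: wl => //; rewrite eq_sym.
rewrite -subset0 => y [/= /andP[yi _] /andP[_ yj]].
have : radius (dyad n j.+1) <= radius (dyad n i.+2).
  by apply: radius_anti => //; rewrite dyad_le.
by move=> /(lt_le_trans yj) /(le_lt_trans yi); rewrite ltxx.
Qed.

Lemma annulus_leb2 n j : leb2 (annulus n j) =
  (pi * (rho ^+ 2 * (dyad n j.+1 `^ (- (2 / alpha)) - dyad n j.+2 `^ (- (2 / alpha)))))%:E.
Proof.
rewrite annulus_area ?radius_ge0//; last by apply: radius_anti; rewrite ?dyad_le.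
by rewrite !radius_sqr//; congr EFin; ring.
Qed.

(** The last cell ends at [dyad n (2 ^ n) = 1], whose radius is [rho]. *)
Lemma annulus_out n j y : (j < (2 ^ n).-1)%N -> dist0 y < rho -> ~ annulus n j y.
Proof.
move=> jn yr /andP[ry _].
have : rho <= radius (dyad n j.+2).
  apply: le_radius; rewrite dyad_gt0/= -(dyad_exp n) dyad_le.
  by move: jn; rewrite -ltnS prednK// expn_gt0.
by move=> /le_trans /(_ ry); rewrite leNgt yr.
Qed.

Lemma annulus_ge_rho n j y : (j < (2 ^ n).-1)%N -> annulus n j y -> rho <= dist0 y.
Proof. by move=> jn yj; rewrite leNgt; apply/negP => /(annulus_out jn). Qed.

Let z := s * rho `^ (- alpha).
Let z_ge0 : 0 <= z. Proof. by rewrite mulr_ge0// powR_ge0. Qed.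

Definition tau (y : R * R) : R := (dist0 y / rho) `^ (- alpha).

Lemma tau01 y : rho <= dist0 y -> 0 < tau y <= 1.
Proof.
move=> ry; have y0 := lt_le_trans rho_gt0 ry.
rewrite powR_gt0 ?divr_gt0//= /tau powRN invf_le1 ?powR_gt0 ?divr_gt0//.
rewrite -[leLHS](_ : 1 `^ alpha = 1); last by rewrite powR1.
apply: ge0_ler_powR => //; rewrite ?nnegrE ?divr_ge0//; try exact: ltW.
by rewrite ler_pdivlMr// mul1r.
Qed.

Lemma annulus_tau n j y : rho <= dist0 y ->
  annulus n j y <-> tau y \in `]dyad n j.+1, dyad n j.+2].
Proof.
move=> ry; have y0 := lt_le_trans rho_gt0 ry.
by rewrite in_itv/= /annulus/= leNgt !lt_radius// -leNgt andbC.
Qed.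

Definition shot (y : R * R) : R :=
  s * (dist0 y `^ (- alpha) * (if rho <= dist0 y then 1 else 0)).

Definition shot_step n : R * R -> R :=
  step_fun (2 ^ n).-1 (annulus n) (fun j => z * dyad n j.+1).

Lemma shot_tau y : rho <= dist0 y -> shot y = z * tau y.
Proof.
move=> ry; have y0 := lt_le_trans rho_gt0 ry.
rewrite /shot ry mulr1 /z /tau -mulrA; congr (_ * _).
by rewrite -powRM ?ltW ?divr_gt0// mulrC divfK// gt_eqF.
Qed.

Lemma shot_out y : dist0 y < rho -> shot y = 0.
Proof. by move=> yr; rewrite /shot leNgt yr/= !mulr0. Qed.

Lemma shot_step_tau n y : rho <= dist0 y -> shot_step n y = z * dyad_sum id n (tau y).
Proof.
move=> ry; rewrite /shot_step /step_fun /dyad_sum mulr_sumr.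
apply: eq_bigr => j _; rewrite -mulrA; congr (_ * (_ * _)).
rewrite !indicE; have [yj|yj] := pselect (annulus n j y).
  by rewrite !mem_set//=; exact/annulus_tau.
by rewrite !memNset//= => /(annulus_tau n j ry).
Qed.

Lemma shot_step_out n y : dist0 y < rho -> shot_step n y = 0.
Proof. by move=> yr; apply: step_fun0 => j jn; exact: annulus_out. Qed.

Lemma shot_step_le n y : shot_step n y <= shot y.
Proof.
have [ry|yr] := leP rho (dist0 y); last by rewrite shot_step_out// shot_out.
rewrite shot_step_tau// shot_tau// ler_wpM2l//.
by have /andP[] := dyad_sum_id n (tau01 ry).
Qed.

Lemma shot_step_nd n y : shot_step n y <= shot_step n.+1 y.
Proof.
have [ry|yr] := leP rho (dist0 y); last by rewrite !shot_step_out.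
by rewrite !shot_step_tau// ler_wpM2l// dyad_sum_nd.
Qed.

Lemma cvg_shot_step y : shot_step n y @[n --> \oo] --> shot y.
Proof.
have [ry|yr] := leP rho (dist0 y); last first.
  rewrite shot_out// (_ : (fun n => _) = cst 0); first exact: cvg_cst.
  by apply/funext => k; rewrite shot_step_out.
rewrite shot_tau//; under eq_fun do rewrite shot_step_tau//.
by apply: cvgM; [exact: cvg_cst|exact: cvg_dyad_sum_id (tau01 ry)].
Qed.

End annuli.

(** * Coverage probability at a fixed serving distance *)

Section coverage.
Context {R : realType} {d : measure_display} {T : measurableType d}.

(** [esum] is a supremum over finite index sets, so negative terms are dropped by the choice of the
    set. Marks, which are nonnegative only almost surely, can thus be replaced by their positive
    parts without discarding a null set. *)
Lemma esum_signed_le (e : nat -> R) (u : R) :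
  (\esum_(i in [set: nat]) (e i)%:E <= u%:E)%E <->
  forall m, \sum_(i < m) Num.max (e i) 0 <= u.
Proof.
have e0 i : (0 <= (Num.max (e i) 0)%:E)%E by rewrite lee_fin le_max lexx orbT.
have -> : (\esum_(i in [set: nat]) (e i)%:E =
    \esum_(i in [set: nat]) (Num.max (e i) 0)%:E)%E.
  apply/eqP; rewrite eq_le; apply/andP; split.
    by apply: le_esum => i _; rewrite lee_fin le_max lexx.
  apply: ge_ereal_sup => _ [X [fX _] <-].
  apply: ereal_sup_ubound; exists (X `&` [set i | 0 < e i]).
    by split => //; exact: finite_setIl.
  rewrite fsbig_mkcondr/=; apply: eq_fsbigr => i _.
  have [ei|ei] := ltP 0 (e i); first by rewrite mem_set.
  by rewrite memNset//=; apply/negP; rewrite -leNgt.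
rewrite -nneseries_esumT//.
split => [eu m|eu].
  rewrite -lee_fin -sumEFin; apply: le_trans eu.
  by rewrite -(big_mkord xpredT (fun i => (Num.max (e i) 0)%:E)); exact: nneseries_lim_ge.
apply: lime_le; first exact: is_cvg_nneseries.
by near=> m; rewrite big_mkord sumEFin lee_fin.
Unshelve. all: by end_near. Qed.

(** Clearing [x^(- alpha)] turns the event, pointwise, into countably many constraints on finite
    sums of the form treated by [race_prob]. *)
Lemma coverage_eventE (h : T -> R) (hs : nat -> T -> R) (pts : T -> nat -> R * R)
    (alpha Pw Nw Theta x rho : R) :
  0 < x -> 0 < Theta ->
  coverage_event h hs pts alpha Pw Nw Theta x rho =
  [set w | forall m, x `^ alpha * Theta * Nw / Pw +
     \sum_(i < m) shot alpha rho (x `^ alpha * Theta) (pts w i) * Num.max (hs i w) 0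
     <= h w].
Proof.
move=> x0 T0; set c := _ / Pw; set s := x `^ alpha * Theta.
have xa : 0 < x `^ alpha by exact: powR_gt0.
have s0 : 0 < s by rewrite mulr_gt0.
have cE : c = s * (Nw / Pw) by rewrite /c /s mulrA.
have covE w : coverage_event h hs pts alpha Pw Nw Theta x rho w <->
    (interference hs pts alpha rho w <= (h w / s - Nw / Pw)%:E)%E.
  rewrite /coverage_event/=; case: (interference hs pts alpha rho w) => [I| |].
  - rewrite -EFinD -EFinM !lee_fin powRN ler_pdivlMr// lerBrDr ler_pdivlMr//.
    by rewrite (_ : Theta * (I + Nw / Pw) * x `^ alpha = (I + Nw / Pw) * s)// /s; ring.
  - by rewrite addye// gt0_muley ?lte_fin.
  - by rewrite addNye gt0_muleNy ?lte_fin// !leNye.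
have shotE w i : s * Num.max (hs i w * dist0 (pts w i) `^ (- alpha) *
    (if rho <= dist0 (pts w i) then 1 else 0)) 0 =
    shot alpha rho s (pts w i) * Num.max (hs i w) 0.
  set k := dist0 _ `^ _; set b := if _ then _ else _.
  have kb0 : 0 <= k * b by rewrite mulr_ge0 ?powR_ge0// /b; case: ifP.
  rewrite -mulrA -[X in Num.max _ X](mul0r (k * b)) -maxr_pMl//.
  by rewrite [RHS]mulrC /shot mulrCA.
have sumE w m : (\sum_(i < m) Num.max (hs i w * dist0 (pts w i) `^ (- alpha) *
    (if rho <= dist0 (pts w i) then 1 else 0)) 0 <= h w / s - Nw / Pw) =
    (c + \sum_(i < m) shot alpha rho s (pts w i) * Num.max (hs i w) 0 <= h w).
  under [in RHS]eq_bigr do rewrite -shotE.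
  rewrite -mulr_sumr lerBrDr ler_pdivlMr// cE; congr (_ <= _); ring.
apply/seteqP; split => w.
  by move=> /covE /esum_signed_le H m; rewrite -sumE.
by move=> H; apply/covE/esum_signed_le => m; rewrite sumE.
Qed.

Lemma sigma_gen_sub (G : set (set T)) : G `<=` measurable -> sigma_gen G `<=` measurable.
Proof. by move=> Gm; apply: smallest_sub => //; exact: sigma_algebra_measurable. Qed.

Lemma conditional_coverage (P : probability T R) (h : T -> R) (hs : nat -> T -> R)
    (pts : T -> nat -> R * R) (alpha Pw Nw Theta x rho lam : R) :
  2 < alpha -> 0 < rho -> 0 < x -> 0 < Theta -> 0 < Pw -> 0 < Nw -> 0 <= lam ->
  SINR_model P h hs pts lam rho ->
  P (coverage_event h hs pts alpha Pw Nw Theta x rho) =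
  (expR (- (x `^ alpha * Theta * Nw / Pw)) *
   expR (- (2 * pi * lam / (alpha - 2) * (x `^ alpha * Theta) *
     (rho ^+ 2) `^ (1 - alpha / 2) * hyp2F1 1 (1 - 2 / alpha) (2 - 2 / alpha)
       (- (x `^ alpha * Theta) * (rho ^+ 2) `^ (- (alpha / 2))))))%:E.
Proof.
move=> a2 r0 x0 T0 P0 N0 l0 [[mh mhs] mpts [eh ehs] ppp indep].
rewrite coverage_eventE//.
set c := _ / Pw; set s := x `^ alpha * Theta.
have a0 : 0 < alpha by exact: lt_trans a2.
have s0 : 0 < s by rewrite mulr_gt0// powR_gt0.
have c0 : 0 <= c by rewrite /c ltW// divr_gt0// mulr_gt0.
set F := (F in mutually_indep _ F) in indep.
have mF j A : F j A -> measurable A.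
  have pre d' (U : measurableType d') (f : T -> U) : measurable_fun setT f ->
      [set f @^-1` C | C in measurable] `<=` measurable.
    by move=> mf _ [C mC <-]; rewrite -[X in measurable X]setTI; exact: mf.
  case: j => [|[|i]]; rewrite /F; apply: sigma_gen_sub.
  - exact: pre.
  - move=> _ [C mC [i _ <-]]; rewrite -[X in measurable X]setTI; exact: mpts.
  - exact: pre.
pose g i w := Num.max (hs i w) 0.
have mmax : measurable_fun setT (fun u : R => Num.max u 0) by exact: measurable_maxr.
have mg i : measurable_fun setT (g i) by exact: measurable_maxr.
have g0 i w : 0 <= g i w by rewrite le_max lexx orbT.
have Fh C : measurable C -> F 0%N (h @^-1` C).
  by move=> mC; apply: sub_sigma_algebra; exists C.
have Fg i C : measurable C -> F i.+2 (g i @^-1` C).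
  move=> mC; apply: sub_sigma_algebra.
  exists ((fun u : R => Num.max u 0) @^-1` C) => //.
  by rewrite -[X in measurable X]setTI; exact: mmax.
have Fpts i C : measurable C -> F 1%N ((fun w => pts w i) @^-1` C).
  by move=> mC; apply: sub_sigma_algebra; exists C => //; exists i.
have sF1 : sigma_algebra setT (F 1%N) by exact: smallest_sigma_algebra.
have race m (b : nat -> R) E : (forall i, 0 <= b i) -> F 1%N E ->
    P ([set w | c + \sum_(i < m) b i * g i w <= h w] `&` E) =
    (P E * (expR (- c) * \prod_(i < m) (1 + b i)^-1)%:E)%E.
  move=> b0 FE; apply: (race_prob indep mF) => //.
  - by move=> t t0; exact: exp1_tail.
  - by move=> i; exact: exp1_laplace.
pose z := s * rho `^ (- alpha).
have z0 : 0 <= z by rewrite mulr_ge0 ?powR_ge0// ltW.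
pose D n := covered_lim h g pts c (2 ^ n).-1 (annulus alpha rho n)
  (fun j => z * dyad n j.+1).
have mD n : measurable (D n).
  apply: measurable_covered_lim => //; exact: measurable_annulus.
have -> : [set w | forall m, c + \sum_(i < m) shot alpha rho s (pts w i) *
    Num.max (hs i w) 0 <= h w] = \bigcap_n D n.
  apply/seteqP; split => w /=.
    move=> cov n _ m _; apply: le_trans (cov m); rewrite lerD2l ler_sum// => i _.
    by rewrite ler_wpM2r ?g0//; apply: shot_step_le => //; exact: ltW.
  (* For fixed [m] the sum is finite, so pointwise convergence of the step functions suffices. *)
  move=> cov m.
  have cv : (c + \sum_(i < m) shot_step alpha rho s n (pts w i) * g i w) @[n --> \oo] -->
      c + \sum_(i < m) shot alpha rho s (pts w i) * g i w.
    apply: cvgD; first exact: cvg_cst.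
    apply: cvg_big => [|i _]; first exact: add_continuous.
    apply: cvgM; last exact: cvg_cst.
    by apply: cvg_shot_step => //; exact: ltW.
  rewrite -(cvg_lim _ cv)//; apply: limr_le; first by apply/cvg_ex; eexists; exact: cv.
  by near=> n; exact: (cov n I m I).
have ndD : nonincreasing_seq D.
  apply/nonincreasing_seqP => n; apply/subsetPset => w cov m _.
  apply: le_trans (cov m I); rewrite lerD2l ler_sum// => i _.
  by rewrite ler_wpM2r ?g0//; apply: shot_step_nd => //; exact: ltW.
pose q := 2 / alpha.
have q01 : 0 < q < 1 by rewrite divr_gt0//= ltr_pdivrMr// mul1r.
pose S n := \sum_(j < (2 ^ n).-1) (1 - (1 + z * dyad n j.+1)^-1) *
    (dyad n j.+1 `^ (- q) - dyad n j.+2 `^ (- q)).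
have PD n : P (D n) = (expR (- c) * expR (- (lam * pi * rho ^+ 2 * S n)))%:E.
  pose mm (j : 'I_(2 ^ n).-1) : R := lam * (pi * (rho ^+ 2 *
    (dyad n j.+1 `^ (- q) - dyad n j.+2 `^ (- q)))).
  rewrite /D (@covered_lim_prob _ _ _ P _ _ _ _ _ sF1 (fun A => @mF 1%N A) Fpts mh mg mpts
    g0 race _ _ _ _ _ _ mm).
  - rewrite -expR_sum; congr (_ * expR _)%:E.
    rewrite sumrN mulr_sumr; congr (- _); apply: eq_bigr => j _.
    by rewrite /mm; ring.
  - by move=> j; exact: measurable_annulus.
  - by move=> i j _ _; exact: annulus_disj.
  - by move=> j; rewrite mulr_ge0// divr_ge0// exprn_ge0.
  - move=> k.
    (* [is_PPP] takes counts indexed by [nat]; the default 0 fills the indices out of range. *)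
    pose k' (j : nat) : nat := if insub j is Some i then k i else 0%N.
    have k'E (j : 'I_(2 ^ n).-1) : k' j = k j by rewrite /k' valK.
    have -> : counts pts (annulus alpha rho n) k = \big[setI/setT]_(j < (2 ^ n).-1)
        [set w | count_eq (pts w) (annulus alpha rho n j) (k' j)].
      rewrite -(bigcap_mkord _ (fun j =>
        [set w | count_eq (pts w) (annulus alpha rho n j) (k' j)])).
      apply/seteqP; split => w kw j /=.
        by move=> jn; have := kw (Ordinal jn) I; rewrite /= -k'E.
      by move=> _; have := kw j (ltn_ord j); rewrite /= k'E.
    rewrite ppp; last 2 first.
    - by move=> j _; split; [exact: measurable_annulus|exact: bounded_annulus].
    - by move=> i j _ _; exact: annulus_disj.
    congr EFin; apply: eq_bigr => j _; rewrite k'E; congr (Defs.poisson_pmf _ _).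
    rewrite (eq_integral (fun=> lam%:E)); last first.
      move=> y; rewrite inE => yj; rewrite ifT//.
      by apply: annulus_ge_rho yj => //; exact: ltn_ord.
    have mA := @measurable_annulus R alpha rho n j.
    rewrite integral_cst//.
    by rewrite -[X in (_ * X)%E]/(leb2 (annulus alpha rho n j)) annulus_leb2.
have q1 : 0 < 1 - q <= 1 by case/andP: q01 => q0 q1; lra.
pose I := fine (\int[lebesgue_measure]_(t in `]0%R, 1%R])
  (t `^ (1 - q - 1) * (1 + z * t)^-1)%:E)%E.
have cvS : S n @[n --> \oo] --> q * z * I by exact: cvg_dyadic_riemann.
have cvP : P (D n) @[n --> \oo] -->
    (expR (- c) * expR (- (lam * pi * rho ^+ 2 * (q * z * I))))%:E.
  apply/fine_cvgP; split; first by near=> n; exact: prob_fin_num.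
  rewrite (_ : _ \o _ = fun n => expR (- c) * expR (- (lam * pi * rho ^+ 2 * S n))).
    apply: cvgM; first exact: cvg_cst.
    apply: continuous_cvg; first exact: continuous_expR.
    by apply: cvgN; apply: cvgM => //; exact: cvg_cst.
  by apply/funext => n /=; rewrite PD.
have := nonincreasing_cvg_mu (mu := P) (F := D).
move=> /(_ _ mD _ ndD) cvP'.
have -> : P (\bigcap_n D n) = (expR (- c) * expR (- (lam * pi * rho ^+ 2 * (q * z * I))))%:E.
  apply: (cvg_unique (@ereal_hausdorff R) _ cvP); apply: cvP'.
    by rewrite (le_lt_trans (probability_le1 _ _))// ltry.
  exact: bigcapT_measurable.
congr (_ * expR (- _))%:E.
have rE (p : R) : (rho ^+ 2) `^ p = rho `^ (2 * p).
  by rewrite -powR_mulrn ?(ltW r0)// -powRrM.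
rewrite !rE.
have -> : 2 * - (alpha / 2) = - alpha by field.
have -> : 2 - 2 / alpha = (1 - q) + 1 by rewrite /q; ring.
rewrite mulNr -/z -/q hyp2F1_euler// -/I.
have -> : rho `^ (2 * (1 - alpha / 2)) = rho ^+ 2 * rho `^ (- alpha).
  have -> : 2 * (1 - alpha / 2) = 2 + (- alpha) by field.
  by rewrite powRD; [rewrite powR_mulrn ?(ltW r0)|apply/implyP => _; rewrite gt_eqF].
(* The factor [1 - 2 / alpha] from [hyp2F1_euler] cancels [alpha - 2] and leaves [2 / alpha = q]. *)
rewrite /z /q; field.
by rewrite gt_eqF//= subr_eq0 gt_eqF.
Unshelve. all: by end_near. Qed.

End coverage.

(** * Gaussian tail, and measurability of [hyp2F1] in its argument *)

Section gaussian_tail.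
Context {R : realType}.
Notation mu := (@lebesgue_measure R).

Lemma integral_gauss_tail (k a : R) : 0 < k -> 0 < a ->
  (\int[mu]_(y in `[a, +oo[) (2 * k * (y * expR (- (k * y ^+ 2))))%:E =
   (expR (- (k * a ^+ 2)))%:E)%E.
Proof.
move=> k0 a0.
have cE : continuous (fun y : R => expR (- (k * y ^+ 2))).
  move=> y; apply: continuous_comp; last exact: continuous_expR.
  apply: cvgN; apply: cvgM; first exact: cvg_cst.
  exact: exprn_continuous.
have dE (y : R) : is_derive y 1 (fun y : R => - expR (- (k * y ^+ 2)))
    (2 * k * (y * expR (- (k * y ^+ 2)))).
  apply: is_derive_eq.
  rewrite -[LHS]/(- (expR (- (k * y ^+ 2)) * - (k * (y * 1 + y * 1)))).
  by ring.
rewrite (@ge0_continuous_FTC2y _ _ (fun y => - expR (- (k * y ^+ 2))) a 0).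
- by rewrite sub0e EFinN oppeK.
- move=> y ay; rewrite !mulr_ge0 ?expR_ge0 ?(ltW k0)//.
  exact: le_trans (ltW a0) ay.
- apply: continuous_subspaceT => y; apply: cvgM; first exact: cvg_cst.
  by apply: cvgM; [exact: cvg_id|exact: cE].
- rewrite -oppr0; apply: cvgN.
  apply: (@cvg_comp _ _ _ (fun y : R => k * y ^+ 2) (fun u : R => expR (- u)) _ +oo%R).
    by apply: gt0_cvgMry => //; exact: cvgr_expr2.
  exact: cvgr_expR.
- by move=> y _; have [] := dE y.
- by apply: cvg_at_right_filter; apply: cvgN; exact: cE.
- by move=> y _; have [_] := dE y; rewrite derive1E.
Qed.

Lemma integral_id0 (m : R) : 0 < m -> (\int[mu]_(t in `]0%R, m]) (t : R)%:E = (m ^+ 2 / 2)%:E)%E.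
Proof.
move=> m0.
have h : (\int[mu]_(t in `]0%R, m]) (2%:E * (t : R)%:E) = (m ^+ 2)%:E)%E.
  rewrite -powR_mulrn ?ltW// -(integral0_powR (ltr0n R 2) m0).
  apply: eq_integral => t; rewrite inE/= in_itv/= => /andP[t0 _].
  rewrite -EFinM; congr (_ * _)%:E.
  by rewrite (_ : 2 - 1 = 1) ?powRr1 ?ltW//; ring.
move: h; rewrite ge0_integralZl//; last first.
  by move=> t; rewrite /= in_itv/= lee_fin => /andP[/ltW].
move=> h; rewrite -[LHS]mul1e -[X in (X * _)%E](_ : (2^-1)%:E * 2%:E = 1)%E; last first.
  by rewrite -EFinM mulVf.
by rewrite -muleA h -EFinM mulrC.
Qed.

(** A partial integral of a nonnegative jointly measurable function. It makes [LI] measurable in the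
    serving distance, for Tonelli. *)
Lemma measurable_hyp2F1 (a b c : R) : measurable_fun setT (hyp2F1 a b c).
Proof.
apply: measurable_funM => //.
pose f (y : R * R) := (y.2 `^ (b - 1) * (1 - y.2) `^ (c - b - 1) *
  (1 - y.1 * y.2) `^ (- a) * \1_[set t : R | 0 < t < 1] y.2)%:E.
have -> : (fun z => fine (\int[mu]_(t in [set t : R | (0 < t < 1)%R])
     (t `^ (b - 1) * (1 - t) `^ (c - b - 1) * (1 - z * t) `^ (- a))%:E)) =
   fine \o (fubini_F mu f).
  by apply/funext => z; rewrite /fubini_F /=; congr fine; rewrite integral_mul_indic.
have mI : measurable [set t : R | 0 < t < 1].
  by rewrite (_ : [set t | _] = `]0, 1[%classic)//; apply/seteqP; split => t; rewrite /= in_itv.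
apply: measurableT_comp => //.
apply: measurable_fun_fubini_tonelli_F.
  apply/measurable_EFinP; repeat apply: measurable_funM.
  - by apply: (measurableT_comp (measurable_powR _)).
  - apply: (measurableT_comp (measurable_powR _)).
    by apply: measurable_funB.
  - apply: (measurableT_comp (measurable_powR _)).
    by apply: measurable_funB => //; exact: measurable_funM.
  - by apply: (measurableT_comp (measurable_indic mI)).
by move=> y; rewrite lee_fin !mulr_ge0 ?powR_ge0// indicE.
Qed.

End gaussian_tail.

(** * The association event, and Tonelli over the two distances *)

Section cell_geometry.
Context {R : realType}.
Variables (lamb alpha Pw Nw M mu : R).
Hypotheses (lamb_gt0 : 0 < lamb) (alpha_gt2 : 2 < alpha) (Pw_gt0 : 0 < Pw)
  (Nw_gt0 : 0 < Nw) (M_ge1 : 1 <= M) (mu12 : 1 <= mu <= 2).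
Notation leb := (@lebesgue_measure R).
Local Notation gUE := (gUE alpha Pw Nw M mu).
Local Notation rhoUE := (rhoUE alpha Pw Nw M mu).
Local Notation A_UE := (A_UE alpha Pw Nw M mu).

Let alpha_gt0 : 0 < alpha. Proof. exact: lt_trans alpha_gt2. Qed.
Let mu_gt0 : 0 < mu. Proof. by case/andP: mu12 => + _; exact: lt_le_trans. Qed.
Let M_gt0 : 0 < M. Proof. exact: lt_le_trans M_ge1. Qed.
Let pl_gt0 : 0 < pi * lamb. Proof. by rewrite mulr_gt0// pi_gt0. Qed.

Let rUE (x : R) : R :=
  x `^ (mu / 2) * (Pw / Nw) `^ ((2 - mu) / (2 * alpha)) * (1 / M) `^ (1 / (2 * alpha)).

(** In logarithms both inequalities are linear, and the second is the first scaled by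
    [mu / 2 > 0]. *)
Lemma le_gUE x y : 0 < x -> 0 < y -> (x <= gUE y) = (rUE x <= y).
Proof.
move=> x0 y0.
have NP : 0 < Nw / Pw by rewrite divr_gt0.
have PN : 0 < Pw / Nw by rewrite divr_gt0.
have M1 : 0 < 1 / M by rewrite divr_gt0.
rewrite -[LHS]ler_ln ?posrE ?mulr_gt0 ?powR_gt0// -[RHS]ler_ln ?posrE ?mulr_gt0 ?powR_gt0//.
rewrite /Defs.gUE /rUE !lnM ?posrE ?mulr_gt0 ?powR_gt0 ?invr_gt0//.
rewrite !ln_powR !lnM ?posrE ?invr_gt0// !lnV ?posrE// ln1.
set lx := ln x; set ly := ln y; set lN := ln Nw; set lP := ln Pw; set lM := ln M.
rewrite -subr_le0 -[RHS]subr_le0.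
set a := (X in (X <= 0) = _); set b := (X in _ = (X <= 0)).
have -> : b = mu / 2 * a.
  by rewrite /a /b; field; rewrite !gt_eqF.
by rewrite pmulr_rle0// divr_gt0.
Qed.

Lemma gUE_gt0 y : 0 < y -> 0 < gUE y.
Proof. by move=> y0; rewrite !mulr_gt0 ?powR_gt0 ?divr_gt0. Qed.

Lemma rhoUE_gt0 x : 0 < x -> 0 < rhoUE x.
Proof. by move=> x0; rewrite /Defs.rhoUE lt_max x0. Qed.

Lemma measurable_gUE : measurable_fun setT gUE.
Proof. by apply: measurable_funM => //; exact: measurable_powR. Qed.

Lemma measurable_rhoUE : measurable_fun setT rhoUE.
Proof.
apply: measurable_maxr => //; apply: measurable_funM => //.
by apply: measurable_funM => //; exact: measurable_powR.
Qed.

Definition support_UE : set (R * R) :=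
  [set q | 0 < q.1] `&` [set q | q.1 < q.2] `&` [set q | q.1 <= gUE q.2].

Lemma measurable_support_UE : measurable support_UE.
Proof.
have mgs : measurable_fun setT (fun q : R * R => gUE q.2).
  by apply: measurableT_comp => //; exact: measurable_gUE.
apply: measurableI; last exact: measurable_set_le.
by apply: measurableI; exact: measurable_set_lt.
Qed.

Definition integrand_UE (G : R -> R) (q : R * R) : R :=
  (2 * pi * lamb) ^+ 2 * q.1 * q.2 * expR (- (pi * lamb * q.2 ^+ 2)) * G q.1 *
  \1_support_UE q.

(** No measurability of [pc] is at hand, so it is replaced pointwise by an explicit [G] before
    Tonelli. Where [x <= 0] leaves [pc] unconstrained, the density vanishes. *)
Lemma joint_densityE (pc : R -> \bar R) (G : R -> R) :
  (forall x, 0 < x -> pc x = (G x)%:E) ->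
  (\int[leb2]_(q in A_UE) ((joint_density lamb q)%:E * pc q.1) =
   \int[leb2]_q (integrand_UE G q)%:E)%E.
Proof.
move=> pcG; rewrite integral_mkcond; apply: eq_integral => q _.
rewrite patchE /integrand_UE indicE /joint_density.
have [qS|qS] := pselect (support_UE q).
  have [[q1 q2] q3] := qS; rewrite !mem_set//= q1 q2/=.
  by rewrite pcG// -EFinM mulr1.
rewrite (memNset qS) mulr0; case: ifPn => // /set_mem qA.
rewrite ifF ?mul0e//; apply/negP => /andP[q1 q2]; exact: qS.
Qed.

Section fubini_UE.
Variable G : R -> R.
Hypothesis mG : measurable_fun setT G.
Hypothesis G_ge0 : forall x, 0 <= G x.

Lemma integrand_UE_ge0 q : (0 <= (integrand_UE G q)%:E)%E.
Proof.
rewrite lee_fin /integrand_UE indicE.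
have [qS|qS] := pselect (support_UE q); last by rewrite (memNset qS) mulr0.
have [[/= q1 q12] _] := qS; have q2 := lt_trans q1 q12.
by rewrite !mulr_ge0 ?expR_ge0 ?sqr_ge0 ?G_ge0 ?pi_ge0 ?(ltW lamb_gt0) ?(ltW q1) ?(ltW q2)//.
Qed.

Lemma measurable_integrand_UE : measurable_fun setT (fun q => (integrand_UE G q)%:E).
Proof.
apply/measurable_EFinP; apply: measurable_funM; last first.
  by apply: measurable_indic; exact: measurable_support_UE.
apply: measurable_funM; last exact: measurableT_comp.
apply: measurable_funM; first by do 2 apply: measurable_funM => //.
apply: measurableT_comp => //; apply: measurableT_comp => //.
by apply: measurable_funM => //; exact: measurable_funX.
Qed.

(** Integrating over [y] first: the section at [x] is a half-line from [rhoUE x], so a Gaussian tail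
    results. *)
Lemma integral_UE1 : (\int[leb2]_q (integrand_UE G q)%:E =
  \int[leb]_(x in [set x : R | (0 < x)%R])
    (2 * pi * lamb * (x * expR (- (pi * lamb * rhoUE x ^+ 2)) * G x))%:E)%E.
Proof.
rewrite /leb2 [LHS](@fubini_tonelli1 _ _ _ _ R leb leb _
  measurable_integrand_UE integrand_UE_ge0).
rewrite [RHS]integral_mkcond; apply: eq_integral => x _; rewrite /fubini_F patchE.
case: ifPn => [|]; last first.
  rewrite notin_setE/= => x0; apply: integral0_eq => y _.
  by rewrite /integrand_UE indicE memNset ?mulr0// => -[[]].
rewrite inE/= => x0.
pose Sx := [set y : R | x < y] `&` [set y : R | rUE x <= y].
transitivity (\int[leb]_y ((2 * pi * lamb * x * G x)%:E *
    (2 * (pi * lamb) * (y * expR (- (pi * lamb * y ^+ 2))) * \1_Sx y)%:E))%E.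
  apply: eq_integral => y _; rewrite -EFinM; congr EFin.
  rewrite /integrand_UE/= !indicE.
  have -> : ((x, y) \in support_UE) = (y \in Sx).
    apply/idP/idP; rewrite !inE /support_UE /Sx /=.
      by move=> [[_ xy]]; rewrite le_gUE//; exact: lt_trans xy.
    by move=> [xy ry]; split => //; rewrite le_gUE//; exact: lt_trans xy.
  by ring.
have mS : measurable Sx.
  by apply: measurableI; [exact: measurable_set_lt|exact: measurable_set_le].
have mf D : measurable_fun D
    (fun y : R => (2 * (pi * lamb) * (y * expR (- (pi * lamb * y ^+ 2))))).
  apply: measurable_funTS; apply: measurable_funM => //; apply: measurable_funM => //.
  apply: measurableT_comp => //; apply: measurableT_comp => //.
  by apply: measurable_funM => //; exact: measurable_funX.
rewrite ge0_integralZl//; last 3 first.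
- apply/measurable_EFinP; apply: measurable_funM; first exact: mf.
  exact: measurable_indic.
- move=> y _; rewrite lee_fin indicE.
  have [[/= yx _]|yS] := pselect (Sx y); last by rewrite (memNset yS) mulr0.
  by rewrite !mulr_ge0 ?expR_ge0 ?pi_ge0 ?(ltW lamb_gt0) ?(ltW (lt_trans x0 yx)).
- by rewrite lee_fin !mulr_ge0 ?(ltW x0) ?(ltW lamb_gt0) ?pi_ge0.
rewrite integral_mul_indic.
have -> : (\int[leb]_(y in Sx) (2 * (pi * lamb) * (y * expR (- (pi * lamb * y ^+ 2))))%:E =
    \int[leb]_(y in `[rhoUE x, +oo[) (2 * (pi * lamb) *
      (y * expR (- (pi * lamb * y ^+ 2))))%:E)%E.
  (* If [x] is the maximum the half-line is open, and adding its endpoint leaves the integral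
     unchanged; otherwise it is already closed. *)
  rewrite /Defs.rhoUE -/(rUE x); have [rx|rx] := leP (rUE x) x.
    rewrite -integral_itv_obnd_cbnd; last exact/measurable_EFinP.
    congr (integral _ _ _); apply/seteqP; split => y; rewrite /Sx/= in_itv/= andbT.
      by move=> [].
    by move=> xy; split => //; exact: le_trans (ltW xy).
  congr (integral _ _ _); apply/seteqP; split => y; rewrite /Sx/= in_itv/= andbT.
    by move=> [].
  by move=> ry; split => //; exact: lt_le_trans ry.
rewrite integral_gauss_tail ?rhoUE_gt0// -EFinM; congr EFin.
by ring.
Qed.

End fubini_UE.

(** The other order: integrating [x] up to the minimum gives half its square, and
    [(2 pi lamb)^2 / 2 = 2 (pi lamb)^2]. *)
Lemma integral_UE2 : (\int[leb2]_q (integrand_UE (fun=> 1%R) q)%:E =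
  \int[leb]_(y in [set y : R | (0 < y)%R])
    (2 * (pi * lamb) ^+ 2 * y * expR (- (pi * lamb * y ^+ 2)) *
     Num.min y (gUE y) ^+ 2)%:E)%E.
Proof.
have m1 : measurable_fun setT (fun _ : R => 1 : R) by [].
have ge1 (x : R) : 0 <= (1 : R) by [].
rewrite /leb2 [LHS](@fubini_tonelli2 _ _ _ _ R leb leb _
  (measurable_integrand_UE m1) (integrand_UE_ge0 ge1)).
rewrite [RHS]integral_mkcond; apply: eq_integral => y _; rewrite /fubini_G patchE.
case: ifPn => [|]; last first.
  rewrite notin_setE/= => y0; apply: integral0_eq => x _.
  rewrite /integrand_UE indicE memNset ?mulr0// => -[[/= x0 xy] _].
  by apply: y0; exact: lt_trans xy.
rewrite inE/= => y0.
pose Sy := [set x : R | 0 < x] `&` [set x : R | x < y] `&` [set x : R | x <= gUE y].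
have mS : measurable Sy.
  apply: measurableI; last exact: measurable_set_le.
  by apply: measurableI; exact: measurable_set_lt.
transitivity (\int[leb]_x (((2 * pi * lamb) ^+ 2 * y * expR (- (pi * lamb * y ^+ 2)))%:E *
    (x * \1_Sy x)%:E))%E.
  apply: eq_integral => x _; rewrite -EFinM; congr EFin.
  rewrite /integrand_UE/= !indicE.
  have -> : ((x, y) \in support_UE) = (x \in Sy) by apply/idP/idP; rewrite !inE.
  by ring.
rewrite ge0_integralZl//; last 3 first.
- apply/measurable_EFinP; apply: measurable_funM => //; exact: measurable_indic.
- move=> x _; rewrite lee_fin indicE.
  have [[[/= x0 _] _]|yS] := pselect (Sy x); last by rewrite (memNset yS) mulr0.
  by rewrite mulr_ge0// ltW.
- by rewrite lee_fin !mulr_ge0 ?expR_ge0 ?sqr_ge0 ?pi_ge0 ?(ltW lamb_gt0) ?(ltW y0).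
rewrite integral_mul_indic.
have -> : (\int[leb]_(x in Sy) (x : R)%:E =
    \int[leb]_(x in `]0%R, Num.min y (gUE y)]) (x : R)%:E)%E.
  have [gy|gy] := ltP (gUE y) y.
    congr (integral _ _ _); apply/seteqP; split => x; rewrite /Sy/= in_itv/=.
      by move=> [[-> _] ->].
    by move=> /andP[x0 xg]; split; [split => //; exact: le_lt_trans gy|].
  rewrite -integral_itv_bndo_bndc; last exact/measurable_EFinP.
  congr (integral _ _ _); apply/seteqP; split => x; rewrite /Sy/= in_itv/=.
    by move=> [[-> ->]].
  by move=> /andP[x0 xy]; split; [split|exact: le_trans (ltW xy) gy].
rewrite integral_id0; last by rewrite lt_min y0 gUE_gt0.
by rewrite -EFinM; congr EFin; field.
Qed.

End cell_geometry.

Theorem theorem1 (R : realType) (lamb alpha Pw Nw M mu Theta : R)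
  (d : measure_display) (T : measurableType d) (P : probability T R)
  (h11 : T -> R) (hs : nat -> T -> R) (pts : R -> T -> nat -> R * R) :
  0 < lamb -> 2 < alpha -> 0 < Pw -> 0 < Nw -> 1 <= M -> 1 <= mu <= 2 ->
  0 < Theta ->
  (forall x11 : R, 0 < x11 ->
     SINR_model P h11 hs (pts x11)
       (lamb * fine (PA_UE lamb alpha Pw Nw M mu)) (rhoUE alpha Pw Nw M mu x11)) ->
  let PA := PA_UE lamb alpha Pw Nw M mu in
  let rho := rhoUE alpha Pw Nw M mu in
  (* coverage probability given X11 = x11 *)
  let pcov := fun x11 : R =>
    P (coverage_event h11 hs (pts x11) alpha Pw Nw Theta x11 (rho x11)) in
  (* C = E[ pcov(X11) | A_UE ] = E[ pcov(X11) 1_{A_UE} ] / P[A_UE] *)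
  let C := ((fine PA)^-1%:E *
            \int[leb2]_(q in A_UE alpha Pw Nw M mu)
               ((joint_density lamb q)%:E * pcov q.1))%E in
  PA = (\int[lebesgue_measure]_(x21 in [set x : R | (0 < x)%R])
          (2 * (pi * lamb) ^+ 2 * x21 * expR (- (pi * lamb * x21 ^+ 2))
           * (Num.min x21 (gUE alpha Pw Nw M mu x21)) ^+ 2)%R%:E)%E /\
  C = ((2 * pi * lamb / fine PA)%:E *
       \int[lebesgue_measure]_(x11 in [set x : R | (0 < x)%R])
         (x11 * expR (- (pi * lamb * rho x11 ^+ 2))
          * expR (- (powR x11 alpha * Theta * Nw / Pw))
          * LI lamb alpha Pw Nw M mu (powR x11 alpha * Theta) x11)%R%:E)%E.
Proof.
move=> lamb0 a2 P0 N0 M1 mu12 T0 model PA rho pcov C; split.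
  (* The association probability is the case where the conditional probability is constantly 1. *)
  rewrite -integral_UE2// -(@joint_densityE _ lamb alpha Pw Nw M mu (fun=> 1%E))//.
  by apply: eq_integral => q _; rewrite mule1.
pose G x := expR (- (powR x alpha * Theta * Nw / Pw)) *
  LI lamb alpha Pw Nw M mu (powR x alpha * Theta) x.
have G0 x : 0 <= G x by rewrite mulr_ge0// expR_ge0.
have mxa : measurable_fun setT (fun x : R => x `^ alpha) by exact: measurable_powR.
have mrho : measurable_fun setT rho by exact: measurable_rhoUE.
have mr2 (p : R) : measurable_fun setT (fun x => (rho x ^+ 2) `^ p).
  by apply: (measurableT_comp (measurable_powR _)); exact: measurable_funX.
have ms : measurable_fun setT (fun x : R => x `^ alpha * Theta) by exact: measurable_funM.
have mG : measurable_fun setT G.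
  apply: measurable_funM.
    apply: measurableT_comp => //; apply: measurableT_comp => //.
    by do 2 apply: measurable_funM => //.
  apply: measurableT_comp => //; apply: measurableT_comp => //.
  apply: measurable_funM.
    by apply: measurable_funM => //; exact: measurable_funM.
  apply: (measurableT_comp (@measurable_hyp2F1 R _ _ _)).
  by apply: measurable_funM => //; exact: measurableT_comp.
(* The model is used at each [x] separately; measurability in [x] comes from the closed form [G]. *)
have pcG x : 0 < x -> pcov x = (G x)%:E.
  move=> x0; rewrite /pcov (conditional_coverage _ _ _ _ _ _ _ (model x x0))//.
  - by rewrite /G /LI -[2 * pi * lamb * _]mulrA.
  - exact: rhoUE_gt0.
  - rewrite mulr_ge0 ?(ltW lamb0)//; apply: fine_ge0; apply: integral_ge0 => q _.
    rewrite lee_fin /joint_density; case: ifP => // /andP[q1 q12].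
    have q2 := lt_trans q1 q12.
    by rewrite !mulr_ge0 ?expR_ge0 ?sqr_ge0 ?pi_ge0 ?(ltW lamb0) ?(ltW q1) ?(ltW q2).
rewrite /C (joint_densityE _ _ _ _ _ _ pcG) integral_UE1//.
have gt0m : measurable [set x : R | 0 < x] by exact: measurable_set_lt.
transitivity ((fine PA)^-1%:E * ((2 * pi * lamb)%:E *
    \int[lebesgue_measure]_(x in [set x : R | (0 < x)%R])
      (x * expR (- (pi * lamb * rho x ^+ 2)) * G x)%:E))%E.
  congr (_ * _)%E; rewrite -ge0_integralZl//.
  - apply/measurable_EFinP; apply: measurable_funTS; apply: measurable_funM => //.
    apply: measurable_funM => //; apply: measurableT_comp => //.
    apply: measurableT_comp => //; apply: measurable_funM => //.
    exact: measurable_funX.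
  - by move=> x /= x0; rewrite lee_fin !mulr_ge0 ?expR_ge0 ?(ltW x0).
  - by rewrite lee_fin !mulr_ge0 ?pi_ge0 ?(ltW lamb0).
rewrite muleA -EFinM [(fine PA)^-1 * _]mulrC; congr (_ * _)%E.
by apply: eq_integral => x _; rewrite /G mulrA.
Qed.
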